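(* Let $R>0$ and let $g\in L^2(\mathbb{R})$ be such that $g\equiv 0$ almost everywhere outside some interval $[a,a+R]$ with $a\in\mathbb{R}$ (or, equivalently, $V_gg\equiv 0$ outside $[-R,R]\times\mathbb{R}$). Then there exist $f,f_1,f_2\in L^2(\mathbb{R})$ satisfying $f_1,f_2\notin\mathbb{T}\cdot f$ as well as $$|V_gf_1|=|V_gf|\quad\text{and}\quad |V_{\hat g}f_2|=|V_{\hat g}f|,$$ i.e. $f$ is neither phase retrievable w.r.t. $g$ nor phase retrievable w.r.t. $\hat g$.
   Context: Let $\mathbb{T}:=\{z\in\mathbb{C} : |z|=1\}$ and $\mathbb{T}\cdot f:=\{\gamma f : \gamma\in\mathbb{T}\}$. For $f,g\in L^2(\mathbb{R})$, the (continuous) short-time Fourier transform of $f$ with respect to the window $g$ is $V_gf(x,\omega):=\int_{\mathbb{R}}f(t)\overline{g(t-x)}e^{-2\pi i t\omega}\,dt$ for $(x,\omega)\in\mathbb{R}^2$. The Fourier transform $\hat g$ of $g\in L^2(\mathbb{R})$ is the unitary extension to $L^2(\mathbb{R})$ of $\hat g(\omega)=\int_{\mathbb{R}}g(t)e^{-2\pi i t\omega}\,dt$. A signal $f\in L^2(\mathbb{R})$ is called phase retrievable w.r.t. $g\in L^2(\mathbb{R})$ if for every $\tilde f\in L^2(\mathbb{R})$ with $|V_g\tilde f|=|V_gf|$ (pointwise on $\mathbb{R}^2$) there exists $\gamma\in\mathbb{T}$ with $\tilde f=\gamma f$. *)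

(* Defs.v *)
From HB Require Import structures.
From mathcomp Require Import all_boot all_order all_algebra.
From mathcomp Require Import complex.
From mathcomp Require Import all_classical all_reals all_analysis.

Set Implicit Arguments.
Unset Strict Implicit.
Unset Printing Implicit Defensive.

Import Order.TTheory GRing.Theory Num.Theory.
Import numFieldNormedType.Exports.
Import ComplexField.Normc.

Local Open Scope classical_set_scope.
Local Open Scope ring_scope.
Local Open Scope complex_scope.

(* The library integrates (extended) real-valued functions only. *)
Definition cintegral {R : realType} (f : R -> R[i]) : R[i] :=
  (\int[lebesgue_measure]_t complex.Re (f t)) +i*
  (\int[lebesgue_measure]_t complex.Im (f t)).

(* Elements of L^p(R; C) are handled through Borel representatives, so that
   equality in L^p is [ae_eq_fun] below. *)
Definition inL {R : realType} (p : \bar R) (f : R -> R[i]) : Prop :=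
  [/\ measurable_fun setT (fun t => complex.Re (f t)),
      measurable_fun setT (fun t => complex.Im (f t)) &
      finite_norm lebesgue_measure p (fun t => normc (f t))].

Definition ae_eq_fun {R : realType} (f h : R -> R[i]) : Prop :=
  {ae lebesgue_measure, forall t : R, f t = h t}.

Definition L2dist {R : realType} (f h : R -> R[i]) : \bar R :=
  'N[lebesgue_measure]_2%:E[(fun t : R => (normc (f t - h t))%:E)]%E.

(* e^{i theta} *)
Definition expi {R : realType} (theta : R) : R[i] := cos theta +i* sin theta.

Definition fourierL1 {R : realType} (g : R -> R[i]) (w : R) : R[i] :=
  cintegral (fun t => g t * expi (- (2 * pi * t * w))).

(* The extension to L^2 by density and continuity: [h] is the L^2-limit of the
   Fourier integrals of functions of L^1 /\ L^2 converging to [g] in L^2. *)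
Definition is_fourierL2 {R : realType} (g h : R -> R[i]) : Prop :=
  exists u : nat -> R -> R[i],
    [/\ forall n, inL 1%E (u n) /\ inL 2%:E (u n),
        L2dist (u n) g @[n --> \oo] --> 0%E &
        L2dist (fourierL1 (u n)) h @[n --> \oo] --> 0%E].

(* A representative of the Fourier transform of [g]; by Plancherel's theorem
   the set below is a single class modulo a.e. equality for [g] in L^2, so the
   default value is never used there. *)
Definition fourierL2 {R : realType} (g : R -> R[i]) : R -> R[i] :=
  xget (cst 0) [set h : R -> R[i] | inL 2%:E h /\ is_fourierL2 g h].

Definition stft {R : realType} (g f : R -> R[i]) (x w : R) : R[i] :=
  cintegral (fun t => f t * (g (t - x))^* * expi (- (2 * pi * t * w))).

(* [h] belongs to T . f, as elements of L^2 *)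
Definition in_phase_orbit {R : realType} (f h : R -> R[i]) : Prop :=
  exists2 c : R[i], normc c = 1 & ae_eq_fun h (fun t => c * f t).

Definition same_spectrogram {R : realType} (g f h : R -> R[i]) : Prop :=
  forall x w : R, normc (stft g h x w) = normc (stft g f x w).

Definition phase_retrievable {R : realType} (g f : R -> R[i]) : Prop :=
  forall h : R -> R[i],
    inL 2%:E h -> same_spectrogram g f h -> in_phase_orbit f h.

(* Main.v *)
(* Two ways of hiding a sign from the spectrogram.

   In time: if [f] vanishes on [[-r, r]], a window of length [r] never sees both
   half-lines at once, so flipping the sign of [f] on the negative half-line
   keeps [|V_g f|].

   In frequency: [V_(g^) p (x, w)] equals the integral over [s] of
   [(g s)^* e^(-2 i pi s x) p^(w - s)], which only depends on [p^] on an interval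
   of length [r].  So if the spectra of [p] and [q] are more than [r] apart, then
   [p + q] and [p - q] have the same spectrogram.

   A single [f] has to do both.  Take step functions of mesh [L = 1 / (2 pi r)]
   with values [s_k] on the cell [|t| / L ~ k].  The transform of such a step
   function is a decaying factor times the cosine series of [s], and multiplying
   [s_k] by [(-1)^k] translates that series by [pi].  A sequence [s] whose cosine
   series vanishes wherever [cos x <= 1/2], and with [s_k = 0] for [k <= m], is
   obtained from the Fourier coefficients of a narrow triangle function
   multiplied by [prod_(l <= m) (cos (k e) - cos (l e))]: each factor spreads the
   support by [e] only.  With [p] the step function of [s_k] and [q] that of
   [(-1)^k s_k], the functions [f = (p + q) / 2] and [f2 = (p - q) / 2] carry the
   even and the odd cells respectively.

   The converse support statement rests on the injectivity of the Fourier
   transform on [L^1]: an integrable function orthogonal to all trigonometric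
   polynomials is orthogonal to the half-lines, whose indicators are bounded
   pointwise limits of such polynomials. *)

Require Import Defs.
From HB Require Import structures.
From mathcomp Require Import all_boot all_order all_algebra.
From mathcomp Require Import complex.
From mathcomp Require Import all_classical all_reals all_analysis.
From mathcomp Require Import measurable_realfun.
From mathcomp Require Import ring lra.

Set Implicit Arguments.
Unset Strict Implicit.
Unset Printing Implicit Defensive.

Import Order.TTheory GRing.Theory Num.Theory.
Import numFieldNormedType.Exports.
Import ComplexField.Normc.

Local Open Scope classical_set_scope.
Local Open Scope ring_scope.
Local Open Scope complex_scope.

Local Notation mu := lebesgue_measure.

(** * Reflections and translations of Lebesgue measure *)

Lemma measurable_subl (R : realType) (c : R) : measurable_fun setT (fun t : R => c - t).
Proof. by apply: measurable_funB => //; exact: measurable_cst. Qed.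

Lemma preimage_subl_itv (R : realType) (c a b : R) :
  (fun t => c - t) @^-1` `]a, b] = `[c - b, c - a[%classic.
Proof.
apply/seteqP; split => t; rewrite /= !in_itv/= => /andP[h1 h2]; apply/andP; split; lra.
Qed.

(** Lebesgue measure is determined by its values on half-open intervals, and a reflection sends []a,
    b]] to [[c - b, c - a[], which has the same length. *)
Lemma lebesgue_measure_subl (R : realType) (c : R) (A : set R) : measurable A ->
  mu ((fun t : R => c - t) @^-1` A) = mu A.
Proof.
move=> mA.
pose f : R -> measurableTypeR R := fun t => c - t.
have mf : measurable_fun setT f by exact: measurable_subl.
pose F : {mfun (R : measurableType _) >-> measurableTypeR R} := mfun_Sub (mem_set mf).
apply/esym; rewrite (_ : mu _ = pushforward mu F A)//.
apply: lebesgue_measure_unique => //= _ [[a b]] _ <-.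
rewrite /pushforward.
rewrite (_ : F @^-1` _ = `[c - b, c - a[%classic); last exact: preimage_subl_itv.
rewrite !lebesgue_measure_itv/= !lte_fin.
by rewrite ltrD2l ltrN2; case: ifP => // _; congr (_%:E); lra.
Qed.

Lemma ge0_integral_subl (R : realType) (c : R) (f : R -> \bar R) :
  measurable_fun setT f -> (forall t, 0 <= f t)%E ->
  (\int[mu]_t f (c - t)%R = \int[mu]_t f t)%E.
Proof.
move=> mf f0.
pose h : R -> measurableTypeR R := fun t => c - t.
have mh : measurable_fun setT h by exact: measurable_subl.
pose F : {mfun (R : measurableType _) >-> measurableTypeR R} := mfun_Sub (mem_set mh).
transitivity (\int[pushforward mu F]_t f t)%E.
  by rewrite ge0_integral_pushforward.
apply: eq_measure_integral => A mA _.
exact: lebesgue_measure_subl.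
Qed.

(** A translation is the composition of two reflections. *)
Lemma ge0_integral_shift (R : realType) (c : R) (f : R -> \bar R) :
  measurable_fun setT f -> (forall t, 0 <= f t)%E ->
  (\int[mu]_t f (t - c)%R = \int[mu]_t f t)%E.
Proof.
move=> mf f0.
rewrite -(@ge0_integral_subl _ c (fun t => f (t - c)))//; last first.
  by apply: measurableT_comp => //; apply: measurable_funB.
rewrite -[RHS](ge0_integral_subl 0)//.
by apply: eq_integral => t _; rewrite addrAC subrr.
Qed.

Lemma ae_imply (R : realType) (P Q : R -> Prop) : (forall t, P t -> Q t) ->
  {ae mu, forall t : R, P t} -> {ae mu, forall t : R, Q t}.
Proof. by move=> PQ; apply: filterS => //; exact: (ae_filter_ringOfSetsType mu). Qed.

Lemma ae_imply2 (R : realType) (P Q S : R -> Prop) : (forall t, P t -> Q t -> S t) ->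
  {ae mu, forall t : R, P t} -> {ae mu, forall t : R, Q t} ->
  {ae mu, forall t : R, S t}.
Proof. by move=> PQ; apply: filterS2 => //; exact: (ae_filter_ringOfSetsType mu). Qed.

Lemma ae_subl (R : realType) (c : R) (P : R -> Prop) :
  {ae mu, forall t, P t} -> {ae mu, forall t, P (c - t)}.
Proof.
move=> [N [mN N0 PN]]; exists ((fun t => c - t) @^-1` N); split.
- by rewrite -[X in measurable X]setTI; exact: measurable_subl.
- by rewrite lebesgue_measure_subl.
- by move=> t nP; apply: PN.
Qed.

Lemma ae_shift (R : realType) (c : R) (P : R -> Prop) :
  {ae mu, forall t, P t} -> {ae mu, forall t, P (t - c)}.
Proof.
move=> /(ae_subl 0) /(ae_subl c); apply: ae_imply => t.
by rewrite sub0r opprB.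
Qed.

(** * Complex integrals and square-integrable functions *)

Lemma normc_ge0 (R : rcfType) (z : R[i]) : 0 <= normc z.
Proof. by case: z => a b; rewrite /normc sqrtr_ge0. Qed.

Lemma normc_sqr (R : rcfType) (z : R[i]) :
  normc z ^+ 2 = complex.Re z ^+ 2 + complex.Im z ^+ 2.
Proof. by case: z => a b; rewrite /normc sqr_sqrtr// addr_ge0// sqr_ge0. Qed.

Lemma normRe_le (R : rcfType) (z : R[i]) : `|complex.Re z| <= normc z.
Proof.
rewrite -(ler_pXn2r (n := 2))// ?nnegrE ?normc_ge0// normc_sqr real_normK ?num_real//.
by rewrite lerDl sqr_ge0.
Qed.

Lemma normIm_le (R : rcfType) (z : R[i]) : `|complex.Im z| <= normc z.
Proof.
rewrite -(ler_pXn2r (n := 2))// ?nnegrE ?normc_ge0// normc_sqr real_normK ?num_real//.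
by rewrite lerDr sqr_ge0.
Qed.

Lemma normc_le (R : rcfType) (z : R[i]) :
  normc z <= `|complex.Re z| + `|complex.Im z|.
Proof.
rewrite -(ler_pXn2r (n := 2))// ?nnegrE ?normc_ge0// normc_sqr.
rewrite sqrrD !real_normK ?num_real//.
have := mulr_ge0 (normr_ge0 (complex.Re z)) (normr_ge0 (complex.Im z)); lra.
Qed.

Lemma normc_conj (R : rcfType) (z : R[i]) : normc z^*%R = normc z.
Proof. by case: z => a b; rewrite /normc /= sqrrN. Qed.

Lemma normc_real (R : rcfType) (a : R) : normc a%:C = `|a|.
Proof. by rewrite /normc/= expr0n addr0 sqrtr_sqr. Qed.

Lemma normc_expi (R : realType) (x : R) : normc (expi x) = 1.
Proof. by rewrite /normc /expi cos2Dsin2 sqrtr1. Qed.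

Lemma expiD (R : realType) (x y : R) : expi (x + y) = expi x * expi y.
Proof. by rewrite /expi cosD sinD; simpc; congr (_ +i* _); ring. Qed.

Lemma expiN (R : realType) (x : R) : expi (- x) = (expi x)^*%R.
Proof. by rewrite /expi cosN sinN. Qed.

Lemma ReM (R : rcfType) (z w : R[i]) : complex.Re (z * w) =
  complex.Re z * complex.Re w - complex.Im z * complex.Im w.
Proof. by case: z; case: w. Qed.

Lemma ImM (R : rcfType) (z w : R[i]) : complex.Im (z * w) =
  complex.Re z * complex.Im w + complex.Im z * complex.Re w.
Proof. by case: z; case: w. Qed.

Lemma ReJ (R : rcfType) (z : R[i]) : complex.Re z^*%R = complex.Re z.
Proof. by case: z. Qed.

Lemma ImJ (R : rcfType) (z : R[i]) : complex.Im z^*%R = - complex.Im z.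
Proof. by case: z. Qed.

Definition cmeasurable d (T : measurableType d) (R : realType) (f : T -> R[i]) :=
  measurable_fun setT (fun t => complex.Re (f t)) /\
  measurable_fun setT (fun t => complex.Im (f t)).

Section cmeasurable.
Context d (T : measurableType d) (R : realType).
Implicit Types f h : T -> R[i].

Lemma cmeasurableM f h :
  cmeasurable f -> cmeasurable h -> cmeasurable (fun t => f t * h t).
Proof.
move=> [f1 f2] [h1 h2]; split.
  under eq_fun do rewrite ReM.
  by apply: measurable_funB; apply: measurable_funM.
under eq_fun do rewrite ImM.
by apply: measurable_funD; apply: measurable_funM.
Qed.

Lemma cmeasurableD f h :
  cmeasurable f -> cmeasurable h -> cmeasurable (fun t => f t + h t).
Proof.
move=> [f1 f2] [h1 h2]; split; under eq_fun do rewrite raddfD/=;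
  exact: measurable_funD.
Qed.

Lemma cmeasurableB f h :
  cmeasurable f -> cmeasurable h -> cmeasurable (fun t => f t - h t).
Proof.
move=> [f1 f2] [h1 h2]; split; under eq_fun do rewrite raddfB/=;
  exact: measurable_funB.
Qed.

Lemma cmeasurableJ f : cmeasurable f -> cmeasurable (fun t => (f t)^*%R).
Proof.
move=> [f1 f2]; split; first by under eq_fun do rewrite ReJ.
by under eq_fun do rewrite ImJ; exact: measurable_funN.
Qed.

Lemma cmeasurable_real (f : T -> R) : measurable_fun setT f ->
  cmeasurable (fun t => (f t)%:C).
Proof. by move=> mf; split => //=; exact: measurable_cst. Qed.

Lemma cmeasurable_cst (c : R[i]) : cmeasurable (cst c : T -> R[i]).
Proof. by split; exact: measurable_cst. Qed.

Lemma measurable_normc f : cmeasurable f -> measurable_fun setT (fun t => normc (f t)).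
Proof.
move=> [f1 f2].
rewrite (_ : (fun _ => _) =
  Num.sqrt \o (fun t => complex.Re (f t) ^+ 2 + complex.Im (f t) ^+ 2)); last first.
  by apply/funext => t; rewrite /= -normc_sqr sqrtr_sqr ger0_norm// normc_ge0.
apply: measurableT_comp.
  by apply: continuous_measurable_fun => x; exact: sqrt_continuous.
by apply: measurable_funD; exact: measurable_funX.
Qed.

End cmeasurable.

Section cintegral.
Variable R : realType.
Implicit Types f h : R -> R[i].

Definition cintegrable f : Prop :=
  mu.-integrable setT (fun t : R => (complex.Re (f t))%:E) /\
  mu.-integrable setT (fun t : R => (complex.Im (f t))%:E).

Lemma cintegrable_measurable f : cintegrable f -> cmeasurable f.
Proof.
move=> [f1 f2]; split; apply/measurable_EFinP.
  exact: (measurable_int mu f1).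
exact: (measurable_int mu f2).
Qed.

Lemma le_cintegrable f (h : R -> R) : cmeasurable f ->
  mu.-integrable setT (fun t => (h t)%:E) -> (forall t, normc (f t) <= h t) ->
  cintegrable f.
Proof.
move=> [mf1 mf2] ih fh; split; apply: le_integrable ih => //.
- exact/measurable_EFinP.
- move=> t _; rewrite /= lee_fin.
  by rewrite (le_trans (normRe_le _))// (le_trans (fh t))// ler_norm.
- exact/measurable_EFinP.
- move=> t _; rewrite /= lee_fin.
  by rewrite (le_trans (normIm_le _))// (le_trans (fh t))// ler_norm.
Qed.

Lemma cintegrable_normc f : cintegrable f ->
  mu.-integrable setT (fun t => (normc (f t))%:E).
Proof.
move=> fi; have mf := cintegrable_measurable fi.
have : mu.-integrable setT (fun t =>
    `|(complex.Re (f t))%:E| + `|(complex.Im (f t))%:E|)%E.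
  by apply: integrableD => //; apply: integrable_abse; [apply: fi.1|apply: fi.2].
apply: le_integrable => //.
  by apply/measurable_EFinP; exact: measurable_normc.
move=> t _; rewrite /= lee_fin ger0_norm ?normc_ge0//.
by rewrite ger0_norm ?addr_ge0// normc_le.
Qed.

Lemma cintegrableP f : cintegrable f <->
  cmeasurable f /\ (\int[mu]_t (normc (f t))%:E < +oo)%E.
Proof.
split=> [fi|[mf fi]].
  split; first exact: cintegrable_measurable.
  have /integrableP[_] := cintegrable_normc fi.
  by under eq_integral do rewrite /= ger0_norm ?normc_ge0//.
apply: (@le_cintegrable _ (fun t => normc (f t))) => //.
apply/integrableP; split; first by apply/measurable_EFinP; exact: measurable_normc.
by under eq_integral do rewrite /= ger0_norm ?normc_ge0//.
Qed.

Lemma inL1P f : inL 1%E f <-> cintegrable f.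
Proof.
rewrite cintegrableP /inL /finite_norm Lnorm1.
have -> : (\int[mu]_x `|(EFin \o (fun t => normc (f t))) x|)%E =
  (\int[mu]_t (normc (f t))%:E)%E.
  by apply: eq_integral => t _; rewrite /= ger0_norm ?normc_ge0.
by split=> [[]|[[]]].
Qed.

Lemma inL2P f : inL 2%:E f <->
  cmeasurable f /\ (\int[mu]_t (normc (f t) ^+ 2)%:E < +oo)%E.
Proof.
rewrite /inL /finite_norm.
have -> : (\int[mu]_t (normc (f t) ^+ 2)%:E)%E =
  ('N[mu]_2%:E [EFin \o (fun t => normc (f t))] `^ 2)%E.
  rewrite poweR_Lnorm//; apply: eq_integral => t _ /=.
  by rewrite ger0_norm ?normc_ge0// powR_mulrn ?normc_ge0.
have -> : ('N[mu]_2%:E [EFin \o (fun t => normc (f t))] `^ 2 < +oo)%E <->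
  ('N[mu]_2%:E [EFin \o (fun t => normc (f t))] < +oo)%E.
  have := Lnorm_ge0 mu 2%:E (EFin \o (fun t => normc (f t))).
  case: ('N[_]_ _[_])%E => [x|//|//] _.
    by rewrite poweR_EFin !ltry.
  by rewrite poweRyr// ltxx.
by split=> [[]|[[]]].
Qed.

Lemma cintegrableD f h : cintegrable f -> cintegrable h ->
  cintegrable (fun t => f t + h t).
Proof.
move=> [f1 f2] [h1 h2]; split.
  by under eq_fun do rewrite raddfD/= EFinD; exact: integrableD.
by under eq_fun do rewrite raddfD/= EFinD; exact: integrableD.
Qed.

Lemma cintegralD f h : cintegrable f -> cintegrable h ->
  cintegral (fun t => f t + h t) = cintegral f + cintegral h.
Proof.
move=> [f1 f2] [h1 h2]; rewrite /cintegral; simpc; congr (_ +i* _).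
  by under eq_Rintegral do rewrite raddfD/=; rewrite RintegralD.
by under eq_Rintegral do rewrite raddfD/=; rewrite RintegralD.
Qed.

Lemma cintegralN f : cintegrable f ->
  cintegral (fun t => - f t) = - cintegral f.
Proof.
move=> [f1 f2]; rewrite /cintegral; simpc; congr (_ +i* _).
  under eq_Rintegral do rewrite raddfN/= -mulN1r.
  by rewrite RintegralZl// mulN1r.
under eq_Rintegral do rewrite raddfN/= -mulN1r.
by rewrite RintegralZl// mulN1r.
Qed.

Lemma cintegrableN f : cintegrable f -> cintegrable (fun t => - f t).
Proof.
move=> [f1 f2]; split; under eq_fun do rewrite raddfN/= EFinN;
  exact: integrableN.
Qed.

Lemma cintegrableB f h : cintegrable f -> cintegrable h ->
  cintegrable (fun t => f t - h t).
Proof. by move=> fi hi; apply: cintegrableD => //; exact: cintegrableN. Qed.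

Lemma cintegralB f h : cintegrable f -> cintegrable h ->
  cintegral (fun t => f t - h t) = cintegral f - cintegral h.
Proof.
move=> fi hi; rewrite cintegralD//; last exact: cintegrableN.
by rewrite cintegralN.
Qed.

Lemma cintegralZ (c : R[i]) f : cintegrable f ->
  cintegral (fun t => c * f t) = c * cintegral f.
Proof.
case: c => a b [f1 f2]; rewrite /cintegral; simpc.
have iZ k (u : R -> R) : mu.-integrable setT (fun t => (u t)%:E) ->
    mu.-integrable setT (fun t => (k * u t)%:E).
  by move=> ui; under eq_fun do rewrite EFinM; exact: integrableZl.
congr (_ +i* _).
  under eq_Rintegral do rewrite ReM/=.
  by rewrite RintegralB//=; [rewrite !RintegralZl|exact: iZ..].
under eq_Rintegral do rewrite ImM/=.
by rewrite RintegralD//=; [rewrite !RintegralZl|exact: iZ..].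
Qed.

Lemma eq_cintegral f h : (forall t, f t = h t) -> cintegral f = cintegral h.
Proof. by move=> fh; congr cintegral; exact/funext. Qed.

Lemma ae_eq_cintegral f h : cmeasurable f -> cmeasurable h ->
  {ae mu, forall t : R, f t = h t} -> cintegral f = cintegral h.
Proof.
move=> [f1 f2] [h1 h2] fh; rewrite /cintegral /Rintegral.
congr (fine _ +i* fine _); apply: ae_eq_integral => //;
  by [exact/measurable_EFinP|apply: ae_imply fh => t ->].
Qed.

(** The real and imaginary parts are bounded separately, which costs the factor [2]. It is harmless,
    as the estimate only serves for boundedness and for limits equal to [0]. *)
Lemma normc_cintegral_le f : cintegrable f ->
  ((normc (cintegral f))%:E <= 2%:E * \int[mu]_t (normc (f t))%:E)%E.
Proof.
move=> fi; have [f1 f2] := fi.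
have mf := cintegrable_measurable fi.
have le (u : R -> R) : mu.-integrable setT (fun t => (u t)%:E) ->
    (forall t, `|u t| <= normc (f t)) ->
    (`|\int[mu]_t u t|%:E <= \int[mu]_t (normc (f t))%:E)%E.
  move=> ui uf; rewrite EFin_normr_Rintegral//.
  apply: (le_trans (le_abse_integral _ _ _)) => //.
    exact: (measurable_int mu ui).
  apply: ge0_le_integral => //.
  - by apply: measurableT_comp => //; exact: (measurable_int mu ui).
  - by apply/measurable_EFinP; exact: measurable_normc.
  - by move=> t _; rewrite /= lee_fin.
rewrite mule_natl mule2n; apply: le_trans (leeD (le _ f1 _) (le _ f2 _)).
- by rewrite -EFinD lee_fin; exact: normc_le.
- by move=> t; exact: normRe_le.
- by move=> t; exact: normIm_le.
Qed.

End cintegral.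

Section square_integrable.
Variable R : realType.
Implicit Types f h : R -> R[i].

Lemma cmeasurable_subl (c : R) f : cmeasurable f -> cmeasurable (fun t : R => f (c - t)).
Proof.
have mc := measurable_subl c.
by move=> [f1 f2]; split; [apply: (measurableT_comp f1 mc)|apply: (measurableT_comp f2 mc)].
Qed.

Lemma cmeasurable_shift (c : R) f : cmeasurable f -> cmeasurable (fun t : R => f (t - c)).
Proof.
move=> /(cmeasurable_subl 0)/(cmeasurable_subl c).
by under eq_fun do rewrite sub0r opprB.
Qed.

Lemma inL2_subl (c : R) f : inL 2%:E f -> inL 2%:E (fun t => f (c - t)).
Proof.
move=> /inL2P[mf fi]; apply/inL2P; split; first exact: cmeasurable_subl.
rewrite (ge0_integral_subl c (f := fun t => (normc (f t) ^+ 2)%:E))//.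
  by apply/measurable_EFinP; apply: measurable_funX; exact: measurable_normc.
by move=> t; rewrite lee_fin sqr_ge0.
Qed.

Lemma inL2_shift (c : R) f : inL 2%:E f -> inL 2%:E (fun t => f (t - c)).
Proof.
move=> /(inL2_subl 0)/(inL2_subl c).
by under eq_fun do rewrite sub0r opprB.
Qed.

Lemma le_inL2 f h : cmeasurable f -> inL 2%:E h ->
  (forall t, normc (f t) <= normc (h t)) -> inL 2%:E f.
Proof.
move=> mf /inL2P[mh hi] fh; apply/inL2P; split => //.
apply: le_lt_trans hi; apply: ge0_le_integral => //.
- by move=> t _; rewrite lee_fin sqr_ge0.
- by apply/measurable_EFinP; apply: measurable_funX; exact: measurable_normc.
- by apply/measurable_EFinP; apply: measurable_funX; exact: measurable_normc.
- by move=> t _; rewrite lee_fin lerXn2r// nnegrE normc_ge0.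
Qed.

Lemma inL2J f : inL 2%:E f -> inL 2%:E (fun t => (f t)^*%R).
Proof.
move=> fi; apply: (le_inL2 _ fi) => [|t]; last by rewrite normc_conj.
by apply: cmeasurableJ; have /inL2P[] := fi.
Qed.

Lemma inL2N f : inL 2%:E f -> inL 2%:E (fun t => - f t).
Proof.
move=> fi; apply: (le_inL2 _ fi) => [|t]; last by rewrite normcN.
have /inL2P[mf _] := fi.
under eq_fun do rewrite -mulN1r.
by apply: cmeasurableM => //; exact: cmeasurable_cst.
Qed.

Lemma cintegrableM f h : inL 2%:E f -> inL 2%:E h -> cintegrable (fun t => f t * h t).
Proof.
move=> /inL2P[mf fi] /inL2P[mh hi].
have sqi (u : R -> R[i]) : cmeasurable u -> (\int[mu]_t (normc (u t) ^+ 2)%:E < +oo)%E ->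
    mu.-integrable setT (fun t => (normc (u t) ^+ 2)%:E).
  move=> m_u ui; apply/integrableP; split.
    by apply/measurable_EFinP; apply: measurable_funX; exact: measurable_normc.
  by under eq_integral do rewrite /= ger0_norm ?sqr_ge0//.
apply: (@le_cintegrable _ _ (fun t => normc (f t) ^+ 2 + normc (h t) ^+ 2)).
- exact: cmeasurableM.
- by under eq_fun do rewrite EFinD; apply: integrableD => //; exact: sqi.
- move=> t; rewrite normcM.
  have := normc_ge0 (f t); have := normc_ge0 (h t); nra.
Qed.

Lemma inL2D f h : inL 2%:E f -> inL 2%:E h -> inL 2%:E (fun t => f t + h t).
Proof.
move=> fi hi; have /inL2P[mf ffi] := fi; have /inL2P[mh hhi] := hi.
apply/inL2P; split; first exact: cmeasurableD.
have m2 (u : R -> R[i]) : cmeasurable u ->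
    measurable_fun setT (fun t => (2 * normc (u t) ^+ 2)%:E).
  move=> m_u; apply/measurable_EFinP; apply: measurable_funM => //.
  by apply: measurable_funX; exact: measurable_normc.
apply: (@le_lt_trans _ _
    (\int[mu]_t ((2 * normc (f t) ^+ 2)%:E + (2 * normc (h t) ^+ 2)%:E))%E).
  apply: ge0_le_integral => //.
  - by move=> t _; rewrite lee_fin sqr_ge0.
  - apply/measurable_EFinP; apply: measurable_funX; apply: measurable_normc.
    exact: cmeasurableD.
  - by apply: emeasurable_funD; exact: m2.
  - move=> t _; rewrite -EFinD lee_fin.
    have := le_normcD (f t) (h t).
    have := normc_ge0 (f t + h t); have := normc_ge0 (f t).
    have := normc_ge0 (h t); have := sqr_ge0 (normc (f t) - normc (h t)); nra.
rewrite ge0_integralD//; last 4 first.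
- by move=> t _; rewrite lee_fin mulr_ge0// sqr_ge0.
- exact: m2.
- by move=> t _; rewrite lee_fin mulr_ge0// sqr_ge0.
- exact: m2.
have lt2 (u : R -> R[i]) : cmeasurable u -> (\int[mu]_t (normc (u t) ^+ 2)%:E < +oo)%E ->
    (\int[mu]_t (2 * normc (u t) ^+ 2)%:E < +oo)%E.
  move=> m_u ui; under eq_integral do rewrite EFinM.
  rewrite ge0_integralZl//.
  - by rewrite lte_mul_pinfty// lee_fin.
  - by apply/measurable_EFinP; apply: measurable_funX; exact: measurable_normc.
  - by move=> t _; rewrite lee_fin sqr_ge0.
by rewrite lte_add_pinfty//; exact: lt2.
Qed.

Lemma cauchy_schwarz f h : cmeasurable f -> cmeasurable h ->
  (\int[mu]_t (normc (f t * h t))%:E <=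
   'N[mu]_2%:E [EFin \o (fun t => normc (f t))] *
   'N[mu]_2%:E [EFin \o (fun t => normc (h t))])%E.
Proof.
move=> mf mh.
have := hoelder mu (measurable_normc mf) (measurable_normc mh)
  (ltr0n R 2) (ltr0n R 2).
have -> : (2%R^-1 + 2%R^-1 = 1 :> R) by lra.
move=> /(_ erefl); rewrite Lnorm1; apply: le_trans.
apply: ge0_le_integral => //.
- by move=> t _; rewrite lee_fin normc_ge0.
- by apply/measurable_EFinP; apply: measurable_normc; exact: cmeasurableM.
- apply: measurableT_comp => //; apply/measurable_EFinP.
  by apply: measurable_funM; exact: measurable_normc.
- by move=> t _; rewrite /= lee_fin normcM ler_norm.
Qed.

End square_integrable.

(** * Short-time Fourier transforms of square-integrable functions *)

Section phase.
Variable R : realType.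

Lemma cmeasurable_expi d (T : measurableType d) (phi : T -> R) :
  measurable_fun setT phi -> cmeasurable (fun t => expi (phi t)).
Proof.
move=> mphi; split => /=.
  apply: (measurableT_comp _ mphi); apply: continuous_measurable_fun.
  exact: continuous_cos.
apply: (measurableT_comp _ mphi); apply: continuous_measurable_fun.
exact: continuous_sin.
Qed.

End phase.

Section stft.
Variable R : realType.
Implicit Types f g h : R -> R[i].

Lemma measurable_phase (w : R) : measurable_fun setT (fun t : R => - (2 * pi * t * w)).
Proof.
apply: measurable_funN; apply: measurable_funM => //.
Qed.

Lemma cmeasurable_stft g f x w : cmeasurable g -> cmeasurable f ->
  cmeasurable (fun t : R => f t * (g (t - x))^* * expi (- (2 * pi * t * w))).
Proof.
move=> mg mf; apply: cmeasurableM; last first.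
  by apply: cmeasurable_expi; exact: measurable_phase.
by apply: cmeasurableM => //; apply: cmeasurableJ; exact: cmeasurable_shift.
Qed.

Lemma cintegrable_stft g f x w : inL 2%:E g -> inL 2%:E f ->
  cintegrable (fun t : R => f t * (g (t - x))^* * expi (- (2 * pi * t * w))).
Proof.
move=> gi fi; have /cintegrableP[mi ii] := cintegrableM fi (inL2J (inL2_shift x gi)).
apply/cintegrableP; split.
  by apply: cmeasurable_stft; [have /inL2P[] := gi|have /inL2P[] := fi].
by under eq_integral do rewrite normcM normc_expi mulr1.
Qed.

Lemma stftD g f h x w : inL 2%:E g -> inL 2%:E f -> inL 2%:E h ->
  stft g (fun t => f t + h t) x w = stft g f x w + stft g h x w.
Proof.
move=> gi fi hi; rewrite -cintegralD; [|exact: cintegrable_stft..].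
by apply: eq_cintegral => t; rewrite !mulrDl.
Qed.

Lemma stftN g f x w : inL 2%:E g -> inL 2%:E f ->
  stft g (fun t => - f t) x w = - stft g f x w.
Proof.
move=> gi fi; rewrite -cintegralN; last exact: cintegrable_stft.
by apply: eq_cintegral => t; rewrite !mulNr.
Qed.

(** Only the products with the translated window are compared, so the signal may be altered freely
    wherever that window vanishes. *)
Lemma ae_eq_stft g f h x w : cmeasurable g -> cmeasurable f -> cmeasurable h ->
  {ae mu, forall t : R, f t * (g (t - x))^* = h t * (g (t - x))^*} ->
  stft g f x w = stft g h x w.
Proof.
move=> mg mf mh fh; apply: ae_eq_cintegral; try exact: cmeasurable_stft.
by apply: ae_imply fh => t ->.
Qed.

End stft.

(** * Fubini's theorem for complex integrands *)

Section fubini.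
Variables (R : realType) (F : R -> R -> R[i]).
Hypothesis mF : cmeasurable (fun z : R * R => F z.1 z.2).
Hypothesis F1 : forall x, cintegrable (F x).
Hypothesis F2 : forall y, cintegrable (F^~ y).
Hypothesis F12 : (\int[mu]_x \int[mu]_y (normc (F x y))%:E < +oo)%E.

Let prod_integrable (u : R -> R -> R) :
  measurable_fun setT (fun z : R * R => u z.1 z.2) ->
  (forall x y, `|u x y| <= normc (F x y)) ->
  (mu \x mu)%E.-integrable setT (fun z : R * R => (u z.1 z.2)%:E).
Proof.
move=> m_u uF; apply/integrable12ltyP; first exact/measurable_EFinP.
have mN : measurable_fun setT (fun z : R * R => (normc (F z.1 z.2))%:E).
  by apply/measurable_EFinP; exact: measurable_normc.
have m_u' : measurable_fun setT (fun z : R * R => `|(u z.1 z.2)%:E|%E).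
  by apply: measurableT_comp => //; exact/measurable_EFinP.
apply: le_lt_trans F12; apply: ge0_le_integral => //.
- by move=> x _; exact: integral_ge0.
- exact: (measurable_fun_fubini_tonelli_F (m2 := mu) _ m_u').
- apply: (measurable_fun_fubini_tonelli_F (m2 := mu) _ mN) => z.
  by rewrite lee_fin normc_ge0.
- move=> x _; apply: ge0_le_integral => //.
  + apply: measurableT_comp => //; apply/measurable_EFinP.
    exact: (measurable_fun_pair2 (f := fun z : R * R => u z.1 z.2)).
  + exact: (measurable_fun_pair2 (f := fun z : R * R => (normc (F z.1 z.2))%:E)).
  + by move=> y _; rewrite lee_fin.
Qed.

(** Integrability of every slice makes each inner extended integral finite, so that the real-valued
    iterated integrals agree with those of Fubini's theorem. *)
Let swap (u : R -> R -> R) :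
  measurable_fun setT (fun z : R * R => u z.1 z.2) ->
  (forall x y, `|u x y| <= normc (F x y)) ->
  (forall x, mu.-integrable setT (fun y => (u x y)%:E)) ->
  (forall y, mu.-integrable setT (fun x => (u x y)%:E)) ->
  (\int[mu]_x \int[mu]_y u x y = \int[mu]_y \int[mu]_x u x y)%R.
Proof.
move=> m_u uF u1 u2; rewrite /Rintegral.
have := Fubini (prod_integrable m_u uF) => /= E.
congr fine; transitivity (\int[mu]_x \int[mu]_y (u x y)%:E)%E.
  by apply: eq_integral => x _; rewrite fineK//; exact: integrable_fin_num.
by rewrite E; apply: eq_integral => x _; rewrite fineK//; exact: integrable_fin_num.
Qed.

Lemma cintegral_fubini : cintegral (fun x => cintegral (fun y => F x y)) =
  cintegral (fun y => cintegral (fun x => F x y)).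
Proof.
rewrite /cintegral /=; congr (_ +i* _).
- apply: (swap (u := fun x y => complex.Re (F x y))).
  + exact: mF.1.
  + by move=> x y; exact: normRe_le.
  + by move=> x; exact: (F1 x).1.
  + by move=> x; exact: (F2 x).1.
- apply: (swap (u := fun x y => complex.Im (F x y))).
  + exact: mF.2.
  + by move=> x y; exact: normIm_le.
  + by move=> x; exact: (F1 x).2.
  + by move=> x; exact: (F2 x).2.
Qed.

End fubini.

(** * Sign flips seen through a window of bounded support *)

Section window_support.
Variable R : realType.
Implicit Types f g : R -> R[i].

Lemma cmeasurable_sign : cmeasurable (fun t : R => if t < 0 then -1 else 1 : R[i]).
Proof.
rewrite (_ : (fun _ => _) = fun t : R => (if t < 0 then -1 else 1 : R)%:C).
  apply: cmeasurable_real; apply: measurable_fun_ifT => //.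
  exact: measurable_fun_ltr.
by apply/funext => t; case: ifP => // _; rewrite rmorphN.
Qed.

Lemma inL2_sign f : inL 2%:E f ->
  inL 2%:E (fun t => (if t < 0 then -1 else 1) * f t).
Proof.
move=> fi; have /inL2P[mf _] := fi.
apply: (le_inL2 _ fi) => [|t].
  by apply: cmeasurableM => //; exact: cmeasurable_sign.
by case: ifP => _; rewrite ?mulN1r ?normcN ?mul1r.
Qed.

(* An interval of length [r] meets at most one of the two half-lines left by a
   gap of length [2 r], so on the support of a translate of [g] the sign flip
   is constant. *)
Lemma same_spectrogram_sign (r a : R) g f : 0 < r -> inL 2%:E g -> inL 2%:E f ->
  {ae mu, forall t : R, t \notin `[a, a + r] -> g t = 0} ->
  (forall t, `|t| <= r -> f t = 0) ->
  same_spectrogram g f (fun t => (if t < 0 then -1 else 1) * f t).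
Proof.
move=> r0 gi fi g0 f0 x w.
have /inL2P[mg _] := gi; have /inL2P[mf _] := fi.
have /inL2P[mf1 _] := inL2_sign fi.
have gx := ae_shift x g0.
(* The translated window lives in [[x + a, x + a + r]]. If its left end is at least [- r], it meets
   only the gap and the right half-line, where the sign is [1]. Otherwise its right end is negative
   and the sign is [-1] on it. *)
have [ax|xa] := leP (- r) (x + a).
  congr normc; apply: ae_eq_stft => //; apply: ae_imply gx => t gt.
  have [t0|t0] := ltP t 0; last by rewrite mul1r.
  have [tr|tr] := leP (- r) t.
    by rewrite f0 ?mulr0// ler_norml tr/=; lra.
  rewrite gt ?rmorph0 ?mulr0// in_itv/=; apply/negP => /andP[]; lra.
rewrite (_ : stft g (fun t => _ * f t) x w = - stft g f x w) ?normcN//.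
rewrite -stftN//; apply: ae_eq_stft => //.
  by have /inL2P[] := inL2N fi.
apply: ae_imply gx => t gt.
have [t0|t0] := ltP t 0; first by rewrite mulN1r.
have [tr|tr] := leP t r.
  by rewrite f0 ?mulr0 ?oppr0 ?mul0r// ler_norml tr andbT; lra.
rewrite gt ?rmorph0 ?mulr0// in_itv/=; apply/negP => /andP[]; lra.
Qed.

End window_support.

(** * Short-time Fourier transforms whose window is a Fourier transform *)

Section fourier.
Variable R : realType.
Implicit Types f g u p : R -> R[i].

Lemma cintegralJ f : cintegrable f ->
  cintegral (fun t => (f t)^*%R) = (cintegral f)^*%R.
Proof.
move=> [f1 f2]; rewrite /cintegral; simpc; congr (_ +i* _).
  by apply: eq_Rintegral => t _; rewrite ReJ.
under eq_Rintegral do rewrite ImJ -mulN1r.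
by rewrite RintegralZl// mulN1r.
Qed.

(** Tonelli's theorem gives measurability for the positive and the negative part, and the integral
    is the difference of the two. *)
Lemma measurable_integral_param (f : R * R -> \bar R) : measurable_fun setT f ->
  measurable_fun setT (fun x => \int[mu]_y f (x, y))%E.
Proof.
move=> mf.
rewrite (_ : (fun x => _) = fubini_F mu f^\+%E \- fubini_F mu f^\-%E)%E.
  apply: emeasurable_funB; apply: measurable_fun_fubini_tonelli_F => //.
    exact: measurable_funepos.
  exact: measurable_funeneg.
apply/funext=> x; rewrite [LHS]integralE.
under eq_integral do rewrite funepos_comp/=.
by under [X in (_ - X)%E = _]eq_integral do rewrite funeneg_comp/=.
Qed.

Lemma cmeasurable_cintegral_param (F : R -> R -> R[i]) :
  cmeasurable (fun z : R * R => F z.1 z.2) -> cmeasurable (fun x => cintegral (F x)).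
Proof.
move=> [m1 m2]; split => /=.
  apply: (measurableT_comp (fine_measurable measurableT)).
  have m1' : measurable_fun setT (fun z : R * R => (complex.Re (F z.1 z.2))%:E).
    exact/measurable_EFinP.
  exact: (measurable_integral_param m1').
apply: (measurableT_comp (fine_measurable measurableT)).
have m2' : measurable_fun setT (fun z : R * R => (complex.Im (F z.1 z.2))%:E).
  exact/measurable_EFinP.
exact: (measurable_integral_param m2').
Qed.

Lemma cmeasurable_fst f : cmeasurable f -> cmeasurable (fun z : R * R => f z.1).
Proof.
move=> [f1 f2]; split.
  exact: (measurableT_comp f1 measurable_fst).
exact: (measurableT_comp f2 measurable_fst).
Qed.

Lemma cmeasurable_snd f : cmeasurable f -> cmeasurable (fun z : R * R => f z.2).
Proof.
move=> [f1 f2]; split.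
  exact: (measurableT_comp f1 measurable_snd).
exact: (measurableT_comp f2 measurable_snd).
Qed.

Lemma cmeasurable_fourierL1 u : cmeasurable u -> cmeasurable (fourierL1 u).
Proof.
move=> m_u.
apply: (cmeasurable_cintegral_param
  (F := fun w t => u t * expi (- (2 * pi * t * w)))).
apply: cmeasurableM; first exact: cmeasurable_snd.
apply: cmeasurable_expi; apply: measurable_funN; apply: measurable_funM => //.
by apply: measurable_funM.
Qed.

Lemma cintegrable_phase u w : cintegrable u ->
  cintegrable (fun t => u t * expi (- (2 * pi * t * w))).
Proof.
move=> /cintegrableP[m_u ui]; apply/cintegrableP; split.
  by apply: cmeasurableM => //; apply: cmeasurable_expi; exact: measurable_phase.
by under eq_integral do rewrite normcM normc_expi mulr1.
Qed.

Lemma fourierL1_bounded u : cintegrable u ->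
  exists M : R, forall w, normc (fourierL1 u w) <= M.
Proof.
move=> ui; have /cintegrableP[_ uoo] := ui.
exists (2 * fine (\int[mu]_t (normc (u t))%:E)) => w.
rewrite -lee_fin EFinM fineK; last first.
  by rewrite ge0_fin_numE// integral_ge0// => t _; rewrite lee_fin normc_ge0.
apply: (le_trans (normc_cintegral_le (cintegrable_phase w ui))).
by under eq_integral do rewrite normcM normc_expi mulr1.
Qed.

Lemma cintegrableJ f : cintegrable f -> cintegrable (fun t => (f t)^*%R).
Proof.
move=> /cintegrableP[mf fi]; apply/cintegrableP; split; first exact: cmeasurableJ.
by under eq_integral do rewrite normc_conj.
Qed.

(* The window enters through its Fourier transform, so the time shift becomes a
   modulation and the modulation a shift. *)
Lemma stft_fourierL1 u p x w : cintegrable u -> cintegrable p ->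
  stft (fourierL1 u) p x w =
  cintegral (fun s => (u s)^* * expi (- (2 * pi * s * x)) * fourierL1 p (w - s)).
Proof.
move=> ui pi_; have /cintegrableP[m_u uoo] := ui.
have /cintegrableP[mp poo] := pi_.
pose F (t s : R) := p t * expi (- (2 * pi * t * w)) *
  ((u s)^* * expi (2 * pi * s * (t - x))).
(* The modulus of the double integrand is a product of functions of one variable, so all the
   integrability conditions of Fubini's theorem reduce to the [L^1] norms of [p] and [u]. *)
have nF t s : normc (F t s) = normc (p t) * normc (u s).
  by rewrite /F !normcM !normc_expi !mulr1 normc_conj.
transitivity (cintegral (fun t => cintegral (F t))).
  apply: eq_cintegral => t; rewrite /fourierL1 -cintegralJ; last exact: cintegrable_phase.
  rewrite mulrAC -cintegralZ; last first.
    by apply: cintegrableJ; exact: cintegrable_phase.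
  by apply: eq_cintegral => s; rewrite rmorphM/= -expiN opprK.
have mF : cmeasurable (fun z : R * R => F z.1 z.2).
  apply: cmeasurableM.
    have mpw : cmeasurable (fun t => p t * expi (- (2 * pi * t * w))).
      apply: cmeasurableM => //; apply: cmeasurable_expi; exact: measurable_phase.
    exact: (cmeasurable_fst mpw).
  apply: cmeasurableM; first exact: (cmeasurable_snd (cmeasurableJ m_u)).
  apply: cmeasurable_expi; apply: measurable_funM.
    by apply: measurable_funM.
  by apply: measurable_funB.
have EM (k : R) : (\int[mu]_s (k * normc (u s))%:E =
    k%:E * \int[mu]_s (normc (u s))%:E)%E.
  under eq_integral do rewrite EFinM.
  by rewrite integralZl//; exact: cintegrable_normc.
have EM' (k : R) : (\int[mu]_t (normc (p t) * k)%:E =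
    k%:E * \int[mu]_s (normc (p s))%:E)%E.
  under eq_integral do rewrite mulrC EFinM.
  by rewrite integralZl//; exact: cintegrable_normc.
have uf : (\int[mu]_s (normc (u s))%:E)%E \is a fin_num.
  by rewrite ge0_fin_numE// integral_ge0// => t _; rewrite lee_fin normc_ge0.
rewrite (cintegral_fubini mF).
- apply: eq_cintegral => s; rewrite /fourierL1 -cintegralZ; last first.
    exact: cintegrable_phase.
  apply: eq_cintegral => t; rewrite /F.
  rewrite [RHS](_ : _ = p t * ((u s)^* *
    (expi (- (2 * pi * s * x)) * expi (- (2 * pi * t * (w - s))))));
    last by ring.
  rewrite [LHS](_ : _ = p t * ((u s)^* *
    (expi (- (2 * pi * t * w)) * expi (2 * pi * s * (t - x))))); last by ring.
  by rewrite -!expiD; congr (_ * (_ * expi _)); ring.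
- move=> t; apply/cintegrableP; split.
    have [m1 m2] := mF; split.
      exact: (measurable_fun_pair2 (f := fun z : R * R => complex.Re (F z.1 z.2))).
    exact: (measurable_fun_pair2 (f := fun z : R * R => complex.Im (F z.1 z.2))).
  under eq_integral do rewrite nF.
  by rewrite EM lte_mul_pinfty// ?lee_fin ?normc_ge0.
- move=> s; apply/cintegrableP; split.
    have [m1 m2] := mF; split.
      exact: (measurable_fun_pair1 (f := fun z : R * R => complex.Re (F z.1 z.2))).
    exact: (measurable_fun_pair1 (f := fun z : R * R => complex.Im (F z.1 z.2))).
  under eq_integral do rewrite nF.
  by rewrite EM' lte_mul_pinfty// ?lee_fin ?normc_ge0.
- under eq_integral => t _.
    under eq_integral do rewrite nF.
    rewrite EM -(fineK uf) -EFinM; over.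
  rewrite EM' lte_mul_pinfty// ?lee_fin ?fine_ge0// integral_ge0// => t _.
  by rewrite lee_fin normc_ge0.
Qed.

Lemma Lnorm2_shift (c : R) f : cmeasurable f ->
  ('N[mu]_2%:E [EFin \o (fun t : R => normc (f (t - c)%R))] =
   'N[mu]_2%:E [EFin \o (fun t : R => normc (f t))])%E.
Proof.
move=> mf; rewrite unlock; congr (_ `^ _)%E.
apply: (ge0_integral_shift c (f := fun t => (`|(normc (f t))%:E| `^ 2)%E)).
  apply: (measurableT_comp (measurable_poweR _)).
  by apply: measurableT_comp => //; apply/measurable_EFinP; exact: measurable_normc.
by move=> t; exact: poweR_ge0.
Qed.

Lemma inL2_Lnorm_fin f : inL 2%:E f ->
  'N[mu]_2%:E [EFin \o (fun t : R => normc (f t))]%E \is a fin_num.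
Proof. by move=> [_ _ fi]; rewrite ge0_fin_numE// Lnorm_ge0. Qed.

(** The formula [stft_fourierL1] holds for the approximants [u n]. Replacing [h] by
    [fourierL1 (u n)] in time, and [g] by [u n] in frequency, each costs a constant times an
    [L2dist] by Cauchy-Schwarz, and both distances tend to [0]. *)
Lemma stft_is_fourierL2_eq0 g h p x w :
  inL 2%:E g -> inL 2%:E h -> is_fourierL2 g h ->
  inL 1%E p -> inL 2%:E p -> inL 2%:E (fourierL1 p) ->
  {ae mu, forall s : R, (g s)^* * fourierL1 p (w - s) = 0} ->
  stft h p x w = 0.
Proof.
move=> gi hi [u [ui ug uh]] /inL1P p1 p2 fp gp0.
have /inL2P[mg _] := gi; have /inL2P[mh _] := hi.
have /inL2P[mp _] := p2; have /inL2P[mfp _] := fp.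
pose Np := ('N[mu]_2%:E [EFin \o (fun t : R => normc (p t))])%E.
pose Nq := ('N[mu]_2%:E [EFin \o (fun s : R => normc (fourierL1 p (w - s)))])%E.
(* The bound is left unsimplified so that it is literally the limit of the sequence [v] below. *)
suff : ((normc (stft h p x w))%:E <= 2%:E * (Np * 0) + 2%:E * (Nq * 0))%E.
  rewrite !mule0 adde0 lee_fin => le0; apply: eq0_normc.
  by apply/eqP; rewrite eq_le le0 normc_ge0.
have Nqfin : Nq \is a fin_num by apply: inL2_Lnorm_fin; exact: inL2_subl.
have Npfin : Np \is a fin_num by exact: inL2_Lnorm_fin.
pose v n := (2%:E * (Np * L2dist (fourierL1 (u n)) h) +
  2%:E * (Nq * L2dist (u n) g))%E.
have vcvg : v @ \oo --> (2%:E * (Np * 0) + 2%:E * (Nq * 0))%E.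
  apply: cvgeD; first by rewrite !mule0 fin_num_adde_defl.
    by apply: cvgeZl => //; exact: cvgeZl.
  by apply: cvgeZl => //; exact: cvgeZl.
apply: cvge_ge vcvg.
apply: nearW => n; have [/inL1P u1 u2] := ui n.
have /inL2P[m_u _] := u2.
have mFu : cmeasurable (fourierL1 (u n)) by exact: cmeasurable_fourierL1.
have iFu : cintegrable (fun t : R =>
    p t * (fourierL1 (u n) (t - x))^* * expi (- (2 * pi * t * w))).
  have [M uM] := fourierL1_bounded u1.
  apply: (@le_cintegrable _ _ (fun t => M * normc (p t))).
  - exact: cmeasurable_stft.
  - by under eq_fun do rewrite EFinM; apply: integrableZl => //; exact: cintegrable_normc.
  - move=> t; rewrite !normcM normc_expi mulr1 normc_conj mulrC.
    by rewrite ler_wpM2r ?normc_ge0.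
rewrite -[stft h p x w](subrK (stft (fourierL1 (u n)) p x w)).
apply: (@le_trans _ _ ((normc (stft h p x w - stft (fourierL1 (u n)) p x w))%:E +
  (normc (stft (fourierL1 (u n)) p x w))%:E)%E).
  by rewrite -EFinD lee_fin le_normcD.
apply: leeD.
  rewrite -cintegralB//; last exact: cintegrable_stft.
  apply: le_trans (normc_cintegral_le _) _.
    by apply: cintegrableB => //; exact: cintegrable_stft.
  rewrite lee_pmul2l//.
  pose d (t : R) := fourierL1 (u n) t - h t.
  have md : cmeasurable d by exact: cmeasurableB.
  rewrite /L2dist -(Lnorm2_shift x md).
  apply: le_trans (cauchy_schwarz mp (cmeasurable_shift x md)).
  rewrite le_eqVlt; apply/orP; left; apply/eqP; apply: eq_integral => t _.
  rewrite -mulrBl normcM normc_expi mulr1 -mulrBr !normcM -rmorphB normc_conj.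
  by rewrite /d -[normc (h _ - _)]normcN opprB.
rewrite stft_fourierL1//.
have mphase : cmeasurable (fun s : R => expi (- (2 * pi * s * x))).
  by apply: cmeasurable_expi; exact: measurable_phase.
have m_ug : cmeasurable (fun s => u n s - g s) by exact: cmeasurableB.
have mfw := cmeasurable_subl w mfp.
have iu : cintegrable (fun s => (u n s - g s)^* * fourierL1 p (w - s)).
  apply: cintegrableM; last exact: inL2_subl.
  by apply: inL2J; apply: inL2D => //; exact: inL2N.
have iu' : cintegrable (fun s => (u n s - g s)^* *
    expi (- (2 * pi * s * x)) * fourierL1 p (w - s)).
  have /cintegrableP[m1 lt1] := iu; apply/cintegrableP; split.
    by apply: cmeasurableM => //; apply: cmeasurableM => //; exact: cmeasurableJ.
  by under eq_integral do rewrite mulrAC normcM normc_expi mulr1.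
(* Since [g] annihilates the reflected and shifted spectrum of [p] almost everywhere, [u n] may be
   replaced by [u n - g] under the integral. *)
rewrite (@ae_eq_cintegral _ _ (fun s => (u n s - g s)^* *
  expi (- (2 * pi * s * x)) * fourierL1 p (w - s))).
- apply: (le_trans (normc_cintegral_le iu')).
  rewrite lee_pmul2l//.
  under eq_integral do rewrite mulrAC normcM normc_expi mulr1 mulrC.
  apply: le_trans (cauchy_schwarz mfw (cmeasurableJ m_ug)) _.
  by rewrite /L2dist; under [X in (_ * 'N[_]_2%:E [EFin \o X])%E]eq_fun do rewrite normc_conj.
- by apply: cmeasurableM => //; apply: cmeasurableM => //; exact: cmeasurableJ.
- exact: cintegrable_measurable iu'.
- apply: ae_imply gp0 => s gs.
  rewrite rmorphB/= !mulrBl [X in _ = _ - X](_ : _ = 0) ?subr0//.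
  by rewrite mulrAC gs mul0r.
Qed.

End fourier.

(** * Derivatives and mean value estimates *)

Section real_calculus.
Variable R : realType.

Lemma is_derive_mull (m y : R) : is_derive y 1 (fun z : R => m * z) m.
Proof.
have := is_deriveZ m (is_derive_id y (1 : R)).
by rewrite /GRing.scale/= mulr1.
Qed.

Lemma is_derive_bigsum (f df : nat -> R -> R) (y : R) n :
  (forall k, is_derive y 1 (f k) (df k y)) ->
  is_derive y 1 (fun z => \sum_(0 <= k < n) f k z) (\sum_(0 <= k < n) df k y).
Proof.
move=> fdf; elim: n => [|n IH].
  rewrite big_geq// (_ : (fun _ => _) = cst 0); first exact: is_derive_cst.
  by apply/funext => z; rewrite big_geq.
rewrite big_nat_recr//= (_ : (fun _ => _) =
  (fun z => \sum_(0 <= k < n) f k z) + f n); first exact: is_deriveD.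
by apply/funext => z; rewrite big_nat_recr.
Qed.

Lemma is_derive_cosM (m y : R) :
  is_derive y 1 (fun z : R => cos (m * z)) (- (m * sin (m * y))).
Proof.
have := is_derive1_comp (is_derive_cos (m * y)) (is_derive_mull m y).
by rewrite mulNr mulrC.
Qed.

Lemma is_derive_sinM (m y : R) :
  is_derive y 1 (fun z : R => sin (m * z)) (m * cos (m * y)).
Proof.
have := is_derive1_comp (is_derive_sin (m * y)) (is_derive_mull m y).
by rewrite mulrC.
Qed.

Lemma is_derive_continuous (f df : R -> R) :
  (forall y : R, is_derive y 1 f (df y)) -> continuous f.
Proof.
move=> fdf y; apply/differentiable_continuous/derivable1_diffP.
exact: (@ex_derive _ _ _ _ _ _ _ (fdf y)).
Qed.

Lemma MVT_global (f df : R -> R) (a b : R) : a <= b ->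
  (forall y : R, is_derive y 1 f (df y)) ->
  exists2 c, a <= c <= b & f b - f a = df c * (b - a).
Proof.
move=> ab fdf; have [|c cab E] := @MVT_segment R f df a b ab (fun y _ => fdf y).
  by apply: continuous_subspaceT; exact: is_derive_continuous fdf.
by exists c => //; move: cab; rewrite in_itv.
Qed.

(** The mean value theorem is applied twice: to [f (x + z) + f (x - z)] on [[0, a]], then to [f1]
    between [x - c] and [x + c]. *)
Lemma second_difference_le (f f1 f2 : R -> R) (x a M : R) : 0 <= a ->
  (forall y : R, is_derive y 1 f (f1 y)) -> (forall y : R, is_derive y 1 f1 (f2 y)) ->
  (forall y, `|y - x| <= a -> `|f2 y| <= M) ->
  `|f (x + a) + f (x - a) - 2 * f x| <= 2 * M * a ^+ 2.
Proof.
move=> a0 ff1 f12 f2M.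
have M0 : 0 <= M by apply: le_trans (f2M x _) => //; rewrite subrr normr0.
have sh (y m : R) : is_derive y 1 (fun z => x + m * z) m.
  rewrite -[m in X in is_derive _ _ _ X]add0r.
  exact: (is_deriveD (is_derive_cst x y 1) (is_derive_mull m y)).
have dphi (y : R) : is_derive y 1 (fun z => f (x + 1 * z) + f (x + -1 * z))
    (f1 (x + 1 * y) * 1 + f1 (x + -1 * y) * -1).
  exact: (is_deriveD (is_derive1_comp (ff1 _) (sh y 1))
    (is_derive1_comp (ff1 _) (sh y (-1)))).
have [c /andP[c0 ca]] := MVT_global a0 dphi.
rewrite !mul1r !mulN1r !mulr1 !mulrN1 subr0 oppr0 addr0 => E.
have [|d /andP[d1 d2] E1] := @MVT_global f1 f2 (x - c) (x + c) _ f12; first by lra.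
have -> : f (x + a) + f (x - a) - 2 * f x = f2 d * (2 * c * a).
  rewrite (_ : _ - _ = f (x + a) + f (x - a) - (f x + f x)); last by lra.
  by rewrite E E1; ring.
rewrite normrM [X in _ * X]ger0_norm; last by rewrite mulr_ge0// mulr_ge0.
have f2d : `|f2 d| <= M.
  by apply: f2M; rewrite ler_norml; apply/andP; split; lra.
apply: (@le_trans _ _ (M * (2 * c * a))).
  by apply: ler_wpM2r => //; rewrite mulr_ge0// mulr_ge0.
have : c * a <= a * a by exact: ler_wpM2r.
by move=> /(ler_wpM2l M0); lra.
Qed.

Lemma cos_lipschitz (x y : R) : `|cos x - cos y| <= `|x - y|.
Proof.
wlog yx : x y / y <= x.
  move=> wl; have [yx|xy] := leP y x; first exact: wl.
  by rewrite distrC [leRHS]distrC; exact/wl/ltW.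
have [c _ ->] := MVT_global yx (@is_derive_cos R).
by rewrite normrM normrN ler_piMl// sin_max.
Qed.

End real_calculus.

(** * Cosine series vanishing on an arc *)

Section cosine_series.
Variable R : realType.
Implicit Types s : nat -> R.

(* Terms of the Fourier series of the even extension of [s] to the integers. *)
Definition cosine_term s (x : R) (k : nat) : R :=
  (if k == 0%N then 1 else 2) * (s k * cos (k%:R * x)).

(** The shift to [k.+1] lets the bound cover index [0]. This decay yields cosine series converging
    absolutely with a bound uniform in [x], and step functions that are [O(1 / (1 + t^2))]. *)
Definition quadratic_decay s := exists C : R, forall k, `|s k| <= C / k.+1%:R ^+ 2.

(** The induction runs on the sharper bound [2 - 1 / n], whose increments dominate the terms
    [1 / n^2]. *)
Lemma sum_inv_sqr_le n : \sum_(0 <= k < n) (k.+1%:R ^+ 2)^-1 <= 2 :> R.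
Proof.
case: n => [|n]; first by rewrite big_geq.
suff : \sum_(0 <= k < n.+1) (k.+1%:R ^+ 2)^-1 <= 2 - n.+1%:R^-1 :> R.
  by move=> /le_trans; apply; rewrite gerBl.
elim: n => [|n IH]; first by rewrite big_nat1 expr1n invr1; lra.
rewrite big_nat_recr//=; apply: le_trans (lerD IH (lexx _)) _.
rewrite -!natr1; set m : R := n%:R; have m0 : 0 <= m by rewrite /m.
rewrite -subr_ge0 (_ : _ - _ = ((m + 1 + 1) ^+ 2 * (m + 1))^-1).
  by rewrite invr_ge0 mulr_ge0// ?sqr_ge0//; lra.
field; apply/andP; split; apply/eqP; lra.
Qed.

Lemma cosine_term_le s C x k : (forall k, `|s k| <= C / k.+1%:R ^+ 2) ->
  `|cosine_term s x k| <= 2 * C * (k.+1%:R ^+ 2)^-1.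
Proof.
move=> sC; rewrite /cosine_term normrM normrM -mulrA; apply: ler_pM => //.
  by case: ifP => _; rewrite ger0_norm//; lra.
by rewrite -[leRHS]mulr1; apply: ler_pM => //; exact: cos_max.
Qed.

Lemma sum_cosine_term_bounded s : quadratic_decay s ->
  exists2 M, 0 <= M & forall x n, \sum_(0 <= k < n) `|cosine_term s x k| <= M.
Proof.
move=> [C sC].
have C0 : 0 <= C by have := le_trans (normr_ge0 _) (sC 0); rewrite expr1n divr1.
exists (2 * C * 2) => [|x n]; first by rewrite mulr_ge0// mulr_ge0.
apply: (@le_trans _ _ (\sum_(0 <= k < n) 2 * C * (k.+1%:R ^+ 2)^-1)).
  by apply: ler_sum => k _; exact: cosine_term_le.
by rewrite -mulr_sumr; apply: ler_wpM2l (sum_inv_sqr_le n); rewrite mulr_ge0.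
Qed.

Lemma cvg_cosine_series s x : quadratic_decay s -> cvgn (series (cosine_term s x)).
Proof.
move=> /sum_cosine_term_bounded[M _ sM]; apply: normed_cvg.
apply: nondecreasing_is_cvgn; first by apply: nondecreasing_series => k _ _; exact: normr_ge0.
by exists M => _ [n _ <-]; exact: sM.
Qed.

(* Up to a factor, the Fourier coefficients of the triangle function supported by
   [[-a, a]] modulo [2 pi]. *)
Definition triangle_coef (a : R) (k : nat) : R :=
  if k == 0%N then a ^+ 2 / 2 else (1 - cos (k%:R * a)) / k%:R ^+ 2.

Lemma quadratic_decay_triangle a : quadratic_decay (triangle_coef a).
Proof.
(* The term [a ^+ 2] serves index [0]. For positive [k], [1 - cos] is at most [2] and
   [(k + 1)^2 <= 4 k^2], whence [8]. *)
exists (8 + a ^+ 2) => -[|k]; rewrite /triangle_coef/=.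
  rewrite expr1n divr1 ger0_norm; first by have := sqr_ge0 a; lra.
  by rewrite mulr_ge0// sqr_ge0.
rewrite -[k.+2%:R]natr1; move: (k.+1%:R : R) (ler1n R k.+1) => m m1.
have {}m1 : 1 <= m by rewrite m1.
have m0 : 0 < m by lra.
have m10 : 0 < m + 1 by lra.
have c1 := cos_le1 (m * a); have c2 := cos_geN1 (m * a).
rewrite ger0_norm; last by rewrite divr_ge0 ?sqr_ge0//; lra.
rewrite ler_pdivrMr ?exprn_gt0// mulrAC ler_pdivlMr ?exprn_gt0//.
have m4 : (m + 1) ^+ 2 <= 4 * m ^+ 2 by nra.
apply: (@le_trans _ _ (2 * (4 * m ^+ 2))).
  by apply: ler_pM => //; rewrite ?sqr_ge0 ?exprn_ge0 ?subr_ge0 //; lra.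
have := mulr_ge0 (sqr_ge0 a) (sqr_ge0 m); lra.
Qed.

(* [H2 N] is a sum of Dirichlet kernels, that is an unnormalised Fejer kernel,
   and [H0 N] is a second antiderivative of it. *)
Let H0 N (y : R) : R := \sum_(0 <= n < N)
  (4^-1 * (y * y) + \sum_(0 <= k < n) - (k.+1%:R ^+ 2)^-1 * cos (k.+1%:R * y)).
Let H1 N (y : R) : R := \sum_(0 <= n < N)
  (2^-1 * y + \sum_(0 <= k < n) k.+1%:R^-1 * sin (k.+1%:R * y)).
Let H2 N (y : R) : R := \sum_(0 <= n < N)
  (2^-1 + \sum_(0 <= k < n) cos (k.+1%:R * y)).

Let dH0 N (y : R) : is_derive y 1 (H0 N) (H1 N y).
Proof.
apply: (is_derive_bigsum (f := fun n y => 4^-1 * (y * y) +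
    \sum_(0 <= k < n) - (k.+1%:R ^+ 2)^-1 * cos (k.+1%:R * y))
  (df := fun n y => 2^-1 * y + \sum_(0 <= k < n) k.+1%:R^-1 * sin (k.+1%:R * y))) => n.
apply: is_deriveD.
  have D := is_deriveZ 4^-1 (is_deriveM (is_derive_id y (1 : R)) (is_derive_id y (1 : R))).
  apply: (is_derive_eq D); rewrite /GRing.scale/=; lra.
apply: (is_derive_bigsum (f := fun k y => - (k.+1%:R ^+ 2)^-1 * cos (k.+1%:R * y))
  (df := fun k y => k.+1%:R^-1 * sin (k.+1%:R * y))) => k.
have D := is_deriveZ (- (k.+1%:R ^+ 2)^-1) (is_derive_cosM k.+1%:R y).
by apply: (is_derive_eq D); rewrite /GRing.scale/=; field.
Qed.

Let dH1 N (y : R) : is_derive y 1 (H1 N) (H2 N y).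
Proof.
apply: (is_derive_bigsum (f := fun n y => 2^-1 * y +
    \sum_(0 <= k < n) k.+1%:R^-1 * sin (k.+1%:R * y))
  (df := fun n y => 2^-1 + \sum_(0 <= k < n) cos (k.+1%:R * y))) => n.
apply: is_deriveD; first exact: is_derive_mull.
apply: (is_derive_bigsum (f := fun k y => k.+1%:R^-1 * sin (k.+1%:R * y))
  (df := fun k y => cos (k.+1%:R * y))) => k.
have D := is_deriveZ (k.+1%:R^-1) (is_derive_sinM k.+1%:R y).
by apply: (is_derive_eq D); rewrite /GRing.scale/= mulKf.
Qed.

(* Multiplication by [2 (1 - cos y)] telescopes each Dirichlet kernel, and then
   their sum. *)
Let H2E N y : 2 * (1 - cos y) * H2 N y = 1 - cos (N%:R * y).
Proof.
have cosS (m : nat) : 2 * cos (m.+1%:R * y) * cos y =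
    cos (m.+2%:R * y) + cos (m%:R * y).
  rewrite (_ : m.+2%:R * y = m.+1%:R * y + y); last by rewrite -natr1; ring.
  rewrite (_ : m%:R * y = m.+1%:R * y - y); last by rewrite -(natr1 m); ring.
  by rewrite cosD cosB; ring.
have D n : 2 * (1 - cos y) * (2^-1 + \sum_(0 <= k < n) cos (k.+1%:R * y)) =
    cos (n%:R * y) - cos (n.+1%:R * y).
  elim: n => [|n IH]; first by rewrite big_geq// addr0 mul0r cos0 mul1r; field.
  rewrite big_nat_recr//= addrA mulrDr IH.
  by have := cosS n; lra.
rewrite /H2; elim: N => [|N IH]; first by rewrite big_geq// mulr0 mul0r cos0 subrr.
by rewrite big_nat_recr//= mulrDr IH D; ring.
Qed.

(* The partial sums are second differences of the terms of [H0], so their means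
   are controlled by the Fejer kernel [H2]. *)
Lemma triangle_series_eq0 (a c x : R) : 0 <= a -> 0 < c ->
  (forall y, `|y - x| <= a -> c <= 1 - cos y) ->
  series (cosine_term (triangle_coef a) x) @ \oo --> 0.
Proof.
move=> a0 c0 hc.
pose V := [sequence series (cosine_term (triangle_coef a) x) n.+1]_n.
(* The second difference of [y^2 / 4] is [a^2 / 2], and that of [- cos (k y) / k^2] is
   [2 (1 - cos (k a)) cos (k x) / k^2]: the terms of the series. The shift by one in [V] lets the
   partial sum start with the term of index [0]. *)
have VE n : V n = (4^-1 * ((x + a) * (x + a)) +
      \sum_(0 <= k < n) - (k.+1%:R ^+ 2)^-1 * cos (k.+1%:R * (x + a))) +
    (4^-1 * ((x - a) * (x - a)) +
      \sum_(0 <= k < n) - (k.+1%:R ^+ 2)^-1 * cos (k.+1%:R * (x - a))) -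
    2 * (4^-1 * (x * x) +
      \sum_(0 <= k < n) - (k.+1%:R ^+ 2)^-1 * cos (k.+1%:R * x)).
  rewrite /V/= /series/=; elim: n => [|n IH].
    by rewrite big_nat1 !big_geq// /cosine_term/= /triangle_coef/= mul0r cos0; field.
  rewrite big_nat_recr//= IH !big_nat_recr//= /cosine_term/= /triangle_coef/=.
  by rewrite !mulrDr !mulrN cosD cosB; field.
have Vsum N : \sum_(0 <= n < N) V n = H0 N (x + a) + H0 N (x - a) - 2 * H0 N x.
  rewrite /H0; elim: N => [|N IH]; first by rewrite !big_geq//; lra.
  by rewrite !big_nat_recr//= IH VE; ring.
(* Near [x] the kernel [H2 N] is a quotient of a number at most [2] by one at least [2 c], hence at
   most [1 / c] whatever [N]. *)
have Vle N : `|\sum_(0 <= n < N) V n| <= 2 * c^-1 * a ^+ 2.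
  rewrite Vsum; apply: (second_difference_le a0 (dH0 N) (dH1 N)) => y /hc cy.
  have cy0 : 0 < 1 - cos y by exact: lt_le_trans cy.
  have -> : H2 N y = (1 - cos (N%:R * y)) / (2 * (1 - cos y)).
    by rewrite -H2E mulrC mulKf// mulf_neq0// gt_eqF.
  have c1 := cos_le1 (N%:R * y); have c2 := cos_geN1 (N%:R * y).
  rewrite ger0_norm; last by rewrite mulr_ge0 ?invr_ge0 ?mulr_ge0//; lra.
  rewrite ler_pdivrMr; last by rewrite mulr_gt0.
  apply: (@le_trans _ _ (c^-1 * (2 * c))).
    by rewrite mulrCA mulVf ?gt_eqF// mulr1; lra.
  by apply: ler_wpM2l; [rewrite invr_ge0 ltW|lra].
have Vcvg : cvgn V.
  apply/cvg_ex; exists (limn (series (cosine_term (triangle_coef a) x))).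
  rewrite /V (cvg_shiftS (series (cosine_term (triangle_coef a) x))).
  exact: cvg_cosine_series (quadratic_decay_triangle a).
(* The sums of [V] are bounded, so its means tend to [0]. As [V] converges, Cesaro's theorem forces
   its limit to be [0] too. *)
have mean0 : arithmetic_mean V @ \oo --> (0 : R).
  apply: (@squeeze_cvgr _ _ _ _ (fun n => - (2 * c^-1 * a ^+ 2 * n.+1%:R^-1))
    (fun n => 2 * c^-1 * a ^+ 2 * n.+1%:R^-1)).
  - apply: nearW => n; rewrite -ler_norml /arithmetic_mean/= normrM.
    rewrite ger0_norm// mulrC; apply: ler_wpM2r => //; exact: Vle.
  - rewrite -oppr0; apply: cvgN; rewrite -(mulr0 (2 * c^-1 * a ^+ 2)).
    by apply: cvgMr; exact: cvg_harmonic.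
  - rewrite -(mulr0 (2 * c^-1 * a ^+ 2)).
    by apply: cvgMr; exact: cvg_harmonic.
have limV : limn V = 0.
  rewrite -(cvg_lim (@Rhausdorff R) (cesaro Vcvg)).
  exact: (cvg_lim (@Rhausdorff R) mean0).
have H : V @ \oo --> limn V by exact: Vcvg.
rewrite limV in H.
by rewrite -(cvg_shiftS (series (cosine_term (triangle_coef a) x))).
Qed.

End cosine_series.

(** * Sequences that start with zeros and whose cosine series vanishes on an arc *)

Section gap_sequence.
Variable R : realType.
Implicit Types s : nat -> R.

Lemma cosine_termM s (e b x : R) k :
  cosine_term (fun k => s k * (cos (k%:R * e) - b)) x k =
  2^-1 * (cosine_term s (x + e) k + cosine_term s (x - e) k) -
  b * cosine_term s x k.
Proof.
by rewrite /cosine_term [k%:R * (x + e)]mulrDr [k%:R * (x - e)]mulrBr cosD cosB; field.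
Qed.

Lemma quadratic_decayM s (e b : R) : `|b| <= 1 -> quadratic_decay s ->
  quadratic_decay (fun k => s k * (cos (k%:R * e) - b)).
Proof.
move=> b1 [C sC]; exists (C * 2) => k; rewrite normrM mulrAC.
apply: ler_pM => //; apply: (le_trans (ler_normB _ _)).
by have := cos_max (k%:R * e); lra.
Qed.

(** Describing the arc through [cos x] makes it periodic and even without reducing [x] modulo
    [2 pi], and lets shifts be controlled by the Lipschitz bound on the cosine. *)
Definition lowpass (c : R) s :=
  forall x, cos x <= c -> series (cosine_term s x) @ \oo --> 0.

(** Multiplying by [cos (k e)] averages the translates of the series by [e] and [- e]. Such a
    translation changes [cos x] by at most [e], which is the loss in the threshold. *)
Lemma lowpassM c s (e b : R) : 0 <= e -> lowpass c s ->
  lowpass (c - e) (fun k => s k * (cos (k%:R * e) - b)).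
Proof.
move=> e0 sc x xc.
have h1 : series (cosine_term s (x + e)) @ \oo --> 0.
  apply: sc; have := cos_lipschitz (x + e) x.
  rewrite (_ : x + e - x = e) ?[`|e|]ger0_norm//; last by ring.
  by rewrite ler_norml => /andP[_]; lra.
have h2 : series (cosine_term s (x - e)) @ \oo --> 0.
  apply: sc; have := cos_lipschitz (x - e) x.
  rewrite (_ : x - e - x = - e) ?normrN ?[`|e|]ger0_norm//; last by ring.
  by rewrite ler_norml => /andP[_]; lra.
have h3 : series (cosine_term s x) @ \oo --> 0 by apply: sc; lra.
rewrite (_ : series _ = (fun n => 2^-1 * (series (cosine_term s (x + e)) n +
    series (cosine_term s (x - e)) n) - b * series (cosine_term s x) n)); last first.
  apply/funext => n; rewrite /series/= -big_split/= !mulr_sumr -sumrB.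
  by apply: eq_bigr => k _; rewrite cosine_termM.
rewrite [X in _ --> X](_ : _ = 2^-1 * (0 + 0) - b * 0); last by lra.
by apply: cvgB; apply: cvgMr => //; exact: cvgD.
Qed.

(* The factor of index [l] kills the coefficient of index [l]. *)
Definition gap_coef (e : R) (m k : nat) : R :=
  triangle_coef e k * \prod_(0 <= l < m) (cos (k%:R * e) - cos (l%:R * e)).

Lemma gap_coefS e m : gap_coef e m.+1 =
  (fun k => gap_coef e m k * (cos (k%:R * e) - cos (m%:R * e))).
Proof. by apply/funext => k; rewrite /gap_coef big_nat_recr//= mulrA. Qed.

Lemma gap_coef0 e : gap_coef e 0 = triangle_coef e.
Proof. by apply/funext => k; rewrite /gap_coef big_geq// mulr1. Qed.

Lemma quadratic_decay_gap e m : quadratic_decay (gap_coef e m).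
Proof.
elim: m => [|m IH]; first by rewrite gap_coef0; exact: quadratic_decay_triangle.
by rewrite gap_coefS; apply: quadratic_decayM => //; exact: cos_max.
Qed.

Lemma lowpass_gap e m : 0 <= e <= 8^-1 ->
  lowpass (5 / 8 - m%:R * e) (gap_coef e m).
Proof.
move=> /andP[e0 e8]; elim: m => [|m IH].
  rewrite gap_coef0 mul0r subr0 => x xc.
  (* From [cos x <= 5 / 8] and [|y - x| <= e <= 1 / 8] follows [cos y <= 3 / 4], whence the constant
     [1 / 4]. *)
  apply: (@triangle_series_eq0 _ _ (1 / 4)) => // y yx.
  have := le_trans (cos_lipschitz y x) yx.
  by rewrite ler_norml => /andP[_]; lra.
rewrite gap_coefS (_ : 5 / 8 - m.+1%:R * e = 5 / 8 - m%:R * e - e).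
  exact: lowpassM.
by rewrite -[m.+1%:R]natr1; ring.
Qed.

Lemma gap_coef_eq0 e m k : (k < m)%N -> gap_coef e m k = 0.
Proof.
move=> km; rewrite /gap_coef (bigD1_seq k) ?mem_index_iota ?iota_uniq//=.
by rewrite subrr mul0r mulr0.
Qed.

(** The cosine is strictly decreasing on [[0, pi]], so none of the factors vanishes while [k e]
    stays below [pi]. *)
Lemma gap_coef_neq0 (e : R) m k : 0 < e -> (m <= k)%N -> (0 < k)%N -> k%:R * e < pi ->
  gap_coef e m k != 0.
Proof.
move=> e0 mk k0 kpi.
have itv (l : nat) : (l <= k)%N -> l%:R * e \in `[0, pi]%R.
  move=> lk; rewrite in_itv/=; apply/andP; split.
    by apply: mulr_ge0 => //; exact: ltW.
  by apply: le_trans (ltW kpi); rewrite ler_pM2r// ler_nat.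
have cosne l : (l < k)%N -> cos (k%:R * e) - cos (l%:R * e) < 0.
  move=> lk; rewrite subr_lt0 ltr_cos ?itv//; last exact: ltnW.
  by rewrite ltr_pM2r// ltr_nat.
rewrite mulf_neq0//.
  rewrite /triangle_coef gtn_eqF// mulf_neq0//.
    by have := cosne _ k0; rewrite mul0r cos0 subr_lt0 subr_eq0 eq_sym => /lt_eqF ->.
  by rewrite invr_neq0// sqrf_eq0 pnatr_eq0 -lt0n.
rewrite prodf_seq_neq0; apply/allP => l; rewrite mem_index_iota /= => lm.
by rewrite lt_eqF// cosne// (leq_trans lm).
Qed.

(** Two consecutive nonzero terms are requested so that both the even and the odd part of [s] are
    nonzero. *)
Lemma exists_gap_sequence (m : nat) : exists s, [/\ quadratic_decay s,
  forall k, (k <= m)%N -> s k = 0, s m.+1 != 0, s m.+2 != 0 & lowpass (1 / 2) s].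
Proof.
(* The [m.+1] factors lower the threshold by [m.+1 * e = 1 / 8] in total, from [5 / 8] to
   [1 / 2]. *)
pose e : R := (8 * m.+1%:R)^-1.
have e0 : 0 < e by rewrite invr_gt0 mulr_gt0.
have m1 : 1 <= m.+1%:R :> R by rewrite ler1n.
have me : m.+1%:R * e = 8^-1 by rewrite /e; field; rewrite gt_eqF//; lra.
have e8 : e <= 8^-1 by rewrite -me ler_peMl// ltW.
have pi2 := pi_ge2 R.
exists (gap_coef e m.+1); split.
- exact: quadratic_decay_gap.
- by move=> k km; apply: gap_coef_eq0.
- by apply: gap_coef_neq0 => //; rewrite me; lra.
- by apply: gap_coef_neq0 => //; rewrite -[m.+2%:R]natr1 mulrDl mul1r me; lra.
- have := @lowpass_gap e m.+1; rewrite me e8 ltW// => /(_ erefl).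
  by rewrite (_ : 5 / 8 - 8^-1 = 1 / 2); last lra.
Qed.

Lemma cosine_term_alternating s x k :
  cosine_term (fun k => (-1) ^+ k * s k) x k = cosine_term s (x + pi) k.
Proof.
rewrite /cosine_term mulrDr [k%:R * pi]mulr_natl (alternatingn (@cosDpi R)).
by congr (_ * _); ring.
Qed.

Lemma lowpass_alternating c s x : lowpass c s -> - c <= cos x ->
  series (cosine_term (fun k => (-1) ^+ k * s k) x) @ \oo --> 0.
Proof.
move=> sc xc; rewrite (_ : cosine_term _ x = cosine_term s (x + pi)).
  by apply: sc; rewrite cosDpi; lra.
by apply/funext => k; rewrite cosine_term_alternating.
Qed.

Lemma quadratic_decay_le s s' : quadratic_decay s ->
  (forall k, `|s' k| <= `|s k|) -> quadratic_decay s'.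
Proof. by move=> [C sC] ss; exists C => k; exact: le_trans (sC k). Qed.

End gap_sequence.

(** * Integrals of sines and cosines, and integrability of [1 / (1 + t^2)] *)

Section trigonometric_integrals.
Variable R : realType.

Lemma Rintegral_FTC (f F : R -> R) (a b : R) : a < b -> continuous f ->
  (forall y : R, is_derive y 1 F (f y)) ->
  \int[mu]_(t in `]a, b[) f t = F b - F a.
Proof.
move=> ab cf dF; have cF := is_derive_continuous dF.
rewrite /Rintegral.
rewrite -(@integral_itv_bndoo _ a b (EFin \o f) true false); last first.
  apply/measurable_EFinP; apply: measurable_funS (continuous_measurable_fun cf) => //.
have -> : (\int[mu]_(x in `[a, b]) (f x)%:E = (F b)%:E - (F a)%:E)%E; last by [].
apply: continuous_FTC2 => //.
- exact: continuous_subspaceT.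
- split.
  + by move=> x _; apply: (@ex_derive _ _ _ _ _ _ _ (dF x)).
  + by apply: cvg_at_right_filter; exact: cF.
  + by apply: cvg_at_left_filter; exact: cF.
- by move=> x _; rewrite derive1E; exact: (@derive_val _ _ _ _ _ _ _ (dF x)).
Qed.

Lemma continuous_cosM (W : R) : continuous (fun t : R => cos (W * t)).
Proof. exact: (is_derive_continuous (is_derive_cosM W)). Qed.

Lemma continuous_sinM (W : R) : continuous (fun t : R => sin (W * t)).
Proof. exact: (is_derive_continuous (is_derive_sinM W)). Qed.

Lemma Rintegral_cos_sym (W b : R) : W != 0 -> 0 < b ->
  \int[mu]_(t in `](- b), b[) cos (W * t) = 2 * sin (W * b) / W.
Proof.
move=> W0 b0.
have dF (y : R) : is_derive y 1 (fun t => W^-1 * sin (W * t)) (cos (W * y)).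
  have D := is_deriveZ W^-1 (is_derive_sinM W y).
  by apply: (is_derive_eq D); rewrite /GRing.scale/= mulKf.
have nb : - b < b by lra.
by rewrite (Rintegral_FTC nb (@continuous_cosM W) dF) mulrN sinN; field.
Qed.

Lemma Rintegral_sin_sym (W b : R) : W != 0 -> 0 < b ->
  \int[mu]_(t in `](- b), b[) sin (W * t) = 0.
Proof.
move=> W0 b0.
have dF (y : R) : is_derive y 1 (fun t => - W^-1 * cos (W * t)) (sin (W * y)).
  have D := is_deriveZ (- W^-1) (is_derive_cosM W y).
  by apply: (is_derive_eq D); rewrite /GRing.scale/=; field.
have nb : - b < b by lra.
by rewrite (Rintegral_FTC nb (@continuous_sinM W) dF) [W * - b]mulrN cosN subrr.
Qed.

(** The integral over the right half-line is [pi / 2], and the left half-line follows by the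
    substitution of [- t] for [t]. *)
Lemma integrable_oneDsqrV :
  mu.-integrable setT (fun t : R => ((1 + t ^+ 2)^-1)%:E).
Proof.
have mf : measurable_fun setT (fun t : R => ((1 + t ^+ 2)^-1)%:E).
  apply/measurable_EFinP; apply: continuous_measurable_fun.
  exact: continuous_oneDsqrV.
have f0 (t : R) : (0 <= ((1 + t ^+ 2)^-1)%:E)%E.
  by rewrite lee_fin invr_ge0 addr_ge0// sqr_ge0.
apply/integrableP; split => //.
under eq_integral do rewrite gee0_abs//.
pose I := (\int[mu]_(t in `[(0:R)%R, +oo[) ((1 + t ^+ 2)^-1)%:E)%E.
have pos : (I < +oo)%E.
  have -> : I = (pi / 2 : R)%:E by exact: integral0y_oneDsqr.
  exact: ltry.
have neg : I = (\int[mu]_(t in `]-oo, (0:R)%R]) ((1 + t ^+ 2)^-1)%:E)%E.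
  rewrite /I ge0_integration_by_substitution0//.
  by under eq_integral do rewrite sqrrN.
rewrite -(setUv `[(0:R), +oo[%classic) ge0_integral_setU//=.
- rewrite lte_add_pinfty// setCitvr.
  apply: (le_lt_trans _ pos); rewrite neg; apply: ge0_subset_integral => //.
    by apply: measurable_funTS.
  by move=> t /=; rewrite !in_itv/= => /ltW.
- exact: measurableC.
- by rewrite setUv.
- exact/disj_setPCl.
Qed.

End trigonometric_integrals.

(** * Step functions and their Fourier transforms *)

Section step_function.
Variables (R : realType) (L : R).
Hypothesis L0 : 0 < L.
Implicit Types s : nat -> R.

(** This rounds [|t| / L] to the nearest integer: cell [0] is an interval of length [L] around [0],
    and cell [k > 0] is a pair of intervals of length [L] centred at [k L] and [- k L]. Step
    functions are thus even. *)
Definition cell_index (t : R) : nat := Num.truncn (`|t| / L + 2^-1).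

Definition step s (t : R) : R := s (cell_index t).

(** [bound 0] is negative, which matches the fact that no cell has an index below [0]. *)
Let bound (k : nat) : R := (k%:R - 2^-1) * L.

Lemma cell_index_lt t k : (cell_index t < k)%N = (`|t| < bound k).
Proof.
rewrite /cell_index truncn_lt_nat; last by rewrite addr_ge0// divr_ge0// ltW.
by rewrite /bound -ltrBrDr ltr_pdivrMr.
Qed.

Lemma cell_index_itv k :
  [set t | (cell_index t < k)%N] = `](- bound k), (bound k)[%classic.
Proof.
by apply/seteqP; split => t /=; rewrite cell_index_lt in_itv/= ltr_norml.
Qed.

Lemma measurable_cells k : measurable [set t | (cell_index t < k)%N].
Proof. by rewrite cell_index_itv. Qed.

Lemma measurable_cell k : measurable [set t | cell_index t = k].
Proof.
rewrite (_ : [set _ | _] = [set t | (cell_index t < k.+1)%N] `\`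
  [set t | (cell_index t < k)%N]).
  by apply: measurableD; exact: measurable_cells.
apply/seteqP; split => t /=; first by move=> ->; rewrite ltnn ltnSn.
by rewrite ltnS leq_eqVlt => -[/orP[/eqP//|->]].
Qed.

Lemma measurable_step s : measurable_fun setT (step s).
Proof.
move=> _ Y mY; rewrite setTI.
rewrite (_ : _ @^-1` _ = \bigcup_(k in [set k | Y (s k)]) [set t | cell_index t = k]).
  by apply: bigcup_measurable => k _; exact: measurable_cell.
apply/seteqP; split => t /=; first by move=> Yt; exists (cell_index t).
by case=> k /= Yk tk; rewrite /step tk.
Qed.

Lemma step_le s : quadratic_decay s ->
  exists2 C, 0 <= C & forall t, `|step s t| <= C * (1 + t ^+ 2)^-1.
Proof.
move=> [C sC].
have C0 : 0 <= C by have := le_trans (normr_ge0 _) (sC 0); rewrite expr1n divr1.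
(* With [u = |t| / L], the constant comes from [1 + (u L)^2 <= (4 + L^2) (u + 1 / 2)^2]. *)
exists (C * (4 + L ^+ 2)) => [|t]; first by rewrite mulr_ge0// addr_ge0// sqr_ge0.
apply: (le_trans (sC _)); rewrite -mulrA; apply: ler_wpM2l => //.
set n : R := (cell_index t).+1%:R.
have nt : `|t| / L + 2^-1 < n.
  by rewrite /n /cell_index truncnS_gt.
have tL : 0 <= `|t| / L by rewrite divr_ge0// ltW.
have n0 : 0 < n by lra.
have t1 : 0 < 1 + t ^+ 2 by have := sqr_ge0 t; lra.
rewrite -[X in X <= _]mul1r ler_pdivrMr ?exprn_gt0// mulrAC ler_pdivlMr// mul1r.
apply: (@le_trans _ _ ((4 + L ^+ 2) * (`|t| / L + 2^-1) ^+ 2)).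
  set u := `|t| / L.
  have -> : t ^+ 2 = (u * L) ^+ 2 by rewrite /u divfK ?gt_eqF// real_normK ?num_real.
  have := sqr_ge0 u; have := sqr_ge0 L; have := mulr_ge0 (sqr_ge0 L) tL.
  rewrite -/u in tL *; nra.
apply: ler_wpM2l; first by rewrite addr_ge0// sqr_ge0.
by rewrite lerXn2r// ?nnegrE; lra.
Qed.

Lemma integrable_step s : quadratic_decay s ->
  mu.-integrable setT (fun t => (step s t)%:E).
Proof.
move=> /step_le[C C0 sC].
have := integrableZl measurableT C (@integrable_oneDsqrV R).
apply: le_integrable => //; first by apply/measurable_EFinP; exact: measurable_step.
move=> t _; rewrite -EFinM /= lee_fin; apply: le_trans (sC t) _; exact: ler_norm.
Qed.

End step_function.

Section step_transform.
Variables (R : realType) (L : R).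
Hypothesis L0 : 0 < L.
Implicit Types s : nat -> R.

Local Notation cells n := [set t | (cell_index L t < n)%N].

(** Every point lies in all but finitely many of the increasing sets [cells n], so dominated
    convergence applies to the truncations of [u]. *)
Lemma cvg_integral_cells (u : R -> R) : mu.-integrable setT (EFin \o u) ->
  (\int[mu]_(t in cells n) u t) @[n --> \oo] --> \int[mu]_t u t.
Proof.
move=> ui.
have m_u : measurable_fun setT u by apply/measurable_EFinP; exact: (measurable_int mu ui).
pose f_ n : R -> \bar R := EFin \o (u \_ (cells n)).
have mf_ n : measurable_fun setT (f_ n).
  apply/measurable_EFinP; apply/(measurable_restrictT _ _).1.
    exact: measurable_cells.
  exact: measurable_funTS.
have f_f : {ae mu, forall t : R, [set: R] t -> f_ ^~ t @ \oo --> (u t)%:E}.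
  apply: aeW => t _; apply: cvg_near_cst; exists (cell_index L t).+1 => // n /= tn.
  by rewrite /f_/= patchE mem_set.
have f_le : {ae mu, forall (t : R) n, [set: R] t -> (`|f_ n t| <= `|u t|%:E)%E}.
  apply: aeW => t n _; rewrite /f_/= lee_fin patchE.
  by case: ifP => // _; rewrite normr0.
have [_ _ H] := @dominated_convergence _ (measurableTypeR R) R mu setT measurableT
  f_ (EFin \o u) _ mf_ (measurable_int mu ui) f_f (integrable_norm ui) f_le.
have ufin : (\int[mu]_x (u x)%:E)%E \is a fin_num by exact: integrable_fin_num.
rewrite -(fineK ufin) in H.
rewrite (_ : (fun n => _) = fine \o [sequence (\int[mu]_x f_ n x)%E]_n).
  exact: fine_cvg H.
by apply/funext => n /=; rewrite Rintegral_mkcond.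
Qed.

Lemma integrable_cells (phi : R -> R) n : continuous phi ->
  mu.-integrable (cells n) (EFin \o phi).
Proof.
move=> cphi; rewrite cell_index_itv//.
set b := _ * L.
have I : mu.-integrable `[- b, b] (EFin \o phi).
  by apply: continuous_compact_integrable; [exact: segment_compact|exact: continuous_subspaceT].
by apply: (integrableS _ _ _ I) => //; exact: subset_itv_oo_cc.
Qed.

Lemma integrable_stepM s (phi : R -> R) : quadratic_decay s -> continuous phi ->
  (forall t, `|phi t| <= 1) ->
  mu.-integrable setT (EFin \o (fun t => step L s t * phi t)).
Proof.
move=> sd cphi phi1; apply: le_integrable (integrable_step L0 sd) => //.
  apply/measurable_EFinP; apply: measurable_funM; first exact: measurable_step.
  exact: continuous_measurable_fun.
by move=> t _; rewrite /= lee_fin normrM ler_piMr.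
Qed.

(** Writing a cell as the difference of two nested symmetric intervals avoids splitting it into its
    two components. *)
Lemma integral_step_cells s (phi : R -> R) n : quadratic_decay s -> continuous phi ->
  (forall t, `|phi t| <= 1) ->
  \int[mu]_(t in cells n) (step L s t * phi t) = \sum_(0 <= k < n)
    s k * (\int[mu]_(t in cells k.+1) phi t - \int[mu]_(t in cells k) phi t).
Proof.
move=> sd cphi phi1; elim: n => [|n IH].
  rewrite big_geq// (_ : cells 0 = set0) ?Rintegral_set0//.
  by apply/seteqP; split.
have cS : cells n.+1 = cells n `|` [set t | cell_index L t = n].
  apply/seteqP; split => t /=.
    by rewrite ltnS leq_eqVlt => /orP[/eqP|]; [right|left].
  by move=> [tn|->]; [exact: ltnW|exact: ltnSn].
have dj : [disjoint cells n & [set t | cell_index L t = n]].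
  by apply/disj_setPS => t [/= + tn]; rewrite tn ltnn.
have mC := measurable_cells L0 n; have mE := measurable_cell L0 n.
rewrite big_nat_recr//= -IH cS Rintegral_setU//; last first.
  by apply: integrableS (integrable_stepM sd cphi phi1) => //; exact: measurableU.
congr (_ + _); have iphi := integrable_cells n.+1 cphi.
rewrite cS in iphi.
rewrite Rintegral_setU// addrAC subrr add0r -RintegralZl//.
  by apply: eq_Rintegral => t; rewrite inE/= /step => ->.
by apply: integrableS iphi => //; exact: measurableU.
Qed.

(** The integral of [cos (W t)] over the cell [k > 0] is [4 sin (W L / 2) cos (k W L) / W]: the
    transform of one interval of length [L], times the cosine that results from its two centres. The
    case [w = 0] is excluded by the division. *)
Lemma fourierL1_stepE s (w : R) : quadratic_decay s -> w != 0 ->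
  exists2 D, series (cosine_term s (2 * pi * w * L)) @ \oo --> D &
  fourierL1 (fun t => (step L s t)%:C) w =
    (2 * sin (2 * pi * w * L / 2) / (2 * pi * w) * D)%:C.
Proof.
move=> sd w0; set W := 2 * pi * w.
have W0 : W != 0 by rewrite !mulf_neq0// gt_eqF// pi_gt0.
have D := @cvg_cosine_series _ _ (W * L) sd.
exists (limn (series (cosine_term s (W * L)))) => //.
have phase t : - (2 * pi * t * w) = - (W * t) by rewrite /W; ring.
have cos1 t : `|cos (W * t)| <= 1 by exact: cos_max.
have sin1 t : `|sin (W * t)| <= 1 by exact: sin_max.
have bp n : 0 < (n.+1%:R - 2^-1) * L.
  by rewrite mulr_gt0// subr_gt0 (lt_le_trans (_ : _ < 1)) ?ler1n//; lra.
have cells0 : cells 0 = set0 :> set R by apply/seteqP; split.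
rewrite /fourierL1 /cintegral; congr (_ +i* _).
  rewrite (_ : (fun t => _) = fun t => step L s t * cos (W * t)); last first.
    by apply/funext => t; rewrite /= phase cosN mul0r subr0.
  have cv := cvg_integral_cells (integrable_stepM sd (@continuous_cosM _ W) cos1).
  rewrite -(cvg_lim (@Rhausdorff R) cv); apply: cvg_lim; first exact: Rhausdorff.
  rewrite (_ : (fun n => _) = fun n =>
      (2 * sin (W * L / 2) / W) * series (cosine_term s (W * L)) n).
    by apply: cvgMr.
  apply/funext => n; rewrite (integral_step_cells _ sd (@continuous_cosM _ W) cos1).
  rewrite /series/= mulr_sumr; apply: eq_bigr => k _.
  (* Cell [0] is a single interval, which explains the coefficient [1] instead of [2] in
     [cosine_term]. *)
  rewrite /cosine_term; case: k => [|k].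
    rewrite cells0 Rintegral_set0 subr0 cell_index_itv// Rintegral_cos_sym///=.
    rewrite mul0r cos0 (_ : W * ((1 - 2^-1) * L) = W * L / 2); last by field.
    by field.
  rewrite !cell_index_itv// !Rintegral_cos_sym//=.
  set x := W * L.
  have -> : W * ((k.+2%:R - 2^-1) * L) = k.+1%:R * x + x / 2.
    by rewrite /x -[k.+2%:R]natr1; field.
  have -> : W * ((k.+1%:R - 2^-1) * L) = k.+1%:R * x - x / 2 by rewrite /x; field.
  by rewrite sinD sinB; field.
(* The imaginary part vanishes, the sine being odd and the cells symmetric. *)
rewrite (_ : (fun t => _) = fun t => step L s t * sin (W * - t)); last first.
  by apply/funext => t; rewrite /= phase mulrN mul0r addr0.
have csin : continuous (fun t : R => sin (W * - t)).
  rewrite (_ : (fun t => _) = fun t => sin (- W * t)); first exact: continuous_sinM.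
  by apply/funext => t; rewrite mulrN mulNr.
have sin1' t : `|sin (W * - t)| <= 1 by exact: sin_max.
have cv := cvg_integral_cells (integrable_stepM sd csin sin1').
rewrite -(cvg_lim (@Rhausdorff R) cv); apply: cvg_lim; first exact: Rhausdorff.
apply: cvg_near_cst; apply: nearW => n.
rewrite (integral_step_cells _ sd csin sin1') big1// => k _.
have z j : \int[mu]_(t in cells j) sin (W * - t) = 0.
  case: j => [|j]; first by rewrite cells0 Rintegral_set0.
  rewrite cell_index_itv//.
  under eq_Rintegral do rewrite mulrN -mulNr.
  by rewrite Rintegral_sin_sym// ?oppr_eq0.
by rewrite !z subrr mulr0.
Qed.

Lemma inL1_step s : quadratic_decay s -> inL 1%E (fun t => (step L s t)%:C).
Proof.
move=> sd; apply/inL1P; split; first exact: integrable_step.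
exact: integrable0.
Qed.

Lemma le_inL2_oneDsqrV (C : R) (f : R -> R[i]) : cmeasurable f ->
  (forall t, normc (f t) ^+ 2 <= C * (1 + t ^+ 2)^-1) -> inL 2%:E f.
Proof.
move=> mf fC; apply/inL2P; split => //.
have := integrableZl measurableT C (@integrable_oneDsqrV R).
move=> /integrableP[_]; apply: le_lt_trans; apply: ge0_le_integral => //.
- by move=> t _; rewrite lee_fin sqr_ge0.
- by apply/measurable_EFinP; apply: measurable_funX; exact: measurable_normc.
- apply: measurableT_comp => //; under eq_fun do rewrite -EFinM.
  apply/measurable_EFinP; apply: measurable_funM => //.
  by apply: continuous_measurable_fun; exact: continuous_oneDsqrV.
- move=> t _; rewrite -EFinM /= lee_fin; apply: le_trans (fC t) _; exact: ler_norm.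
Qed.

Lemma inL2_step s : quadratic_decay s -> inL 2%:E (fun t => (step L s t)%:C).
Proof.
move=> sd; have [C C0 sC] := step_le L0 sd.
apply: (@le_inL2_oneDsqrV (C ^+ 2)).
  by apply: cmeasurable_real; exact: measurable_step.
move=> t; rewrite normc_real.
have t1 : 1 <= 1 + t ^+ 2 by rewrite lerDl sqr_ge0.
have t0 : 0 < 1 + t ^+ 2 by exact: lt_le_trans t1.
apply: (@le_trans _ _ ((C * (1 + t ^+ 2)^-1) ^+ 2)).
  by rewrite lerXn2r// nnegrE mulr_ge0// invr_ge0 ltW.
rewrite exprMn; apply: ler_wpM2l; first exact: sqr_ge0.
by rewrite expr2 ler_piMl ?invr_ge0 ?(ltW t0)// invf_le1.
Qed.

(** The transform is bounded by [M1], and by the explicit formula its product with [w] is bounded by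
    [M]. Together these give [(1 + w^2) |F w|^2 <= M1^2 + M^2]. *)
Lemma inL2_fourierL1_step s : quadratic_decay s ->
  inL 2%:E (fourierL1 (fun t => (step L s t)%:C)).
Proof.
move=> sd; have /inL1P i1 := inL1_step sd.
have [M1 fM1] := fourierL1_bounded i1.
have [M M0 sM] := sum_cosine_term_bounded sd.
apply: (@le_inL2_oneDsqrV (M1 ^+ 2 + M ^+ 2)).
  by apply: cmeasurable_fourierL1; have /cintegrableP[] := i1.
move=> w; have w1 : 0 < 1 + w ^+ 2 by rewrite ltr_pwDl// sqr_ge0.
rewrite ler_pdivlMr// mulrDr mulr1; apply: lerD.
  by rewrite lerXn2r// nnegrE ?normc_ge0//; exact: le_trans (normc_ge0 _) (fM1 w).
have [->|w0] := eqVneq w 0; first by rewrite expr0n mulr0 sqr_ge0.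
have [D cD ->] := fourierL1_stepE sd w0.
have DM : `|D| <= M.
  have Dn : (fun n => `|series (cosine_term s (2 * pi * w * L)) n|) @ \oo --> `|D|.
    exact: cvg_norm.
  apply: (cvgr_to_le Dn); apply: nearW => n.
  by apply: (le_trans (ler_norm_sum _ _ _)); exact: sM.
rewrite normc_real real_normK ?num_real// -exprMn.
rewrite -real_normK ?num_real//.
rewrite lerXn2r// ?nnegrE//.
have cancel_w (q S : R) : q != 0 -> 2 * S / (2 * q * w) * D * w = q^-1 * S * D.
  by move=> q0; field; rewrite w0 q0.
rewrite cancel_w ?gt_eqF ?pi_gt0//.
have pi1 : `|pi^-1 : R| <= 1.
  have := pi_ge2 R => pi2.
  by rewrite ger0_norm ?invr_ge0 ?pi_ge0// invf_le1 ?pi_gt0//; lra.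
rewrite normrM -[M]mul1r; apply: ler_pM => //.
by rewrite normrM -[leRHS]mul1r; apply: ler_pM => //; exact: sin_max.
Qed.

End step_transform.

(** * Injectivity of the Fourier transform on L^1 *)

Section trigonometric_uniqueness.
Variable R : realType.
Implicit Types h : R -> R.

(** The free phase [c] covers cosines and sines at once and keeps the property stable under
    multiplication by a sinusoid. *)
Definition trig_orthogonal h := mu.-integrable setT (EFin \o h) /\
  forall w c, \int[mu]_t (h t * cos (w * t + c)) = 0.

Lemma continuous_cos_affine (w c : R) : continuous (fun t : R => cos (w * t + c)).
Proof.
move=> t; apply: (@continuous_comp _ _ _ (fun t => w * t + c) cos).
  by apply: continuousD; [exact: mulrl_continuous|exact: cst_continuous].
exact: continuous_cos.
Qed.

Lemma integrable_mul_bounded h (phi : R -> R) : mu.-integrable setT (EFin \o h) ->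
  measurable_fun setT phi -> (forall t, `|phi t| <= 1) ->
  mu.-integrable setT (EFin \o (fun t => h t * phi t)).
Proof.
move=> hi mphi phi1; have /measurable_EFinP mh := measurable_int mu hi.
apply: le_integrable hi => //.
  by apply/measurable_EFinP; exact: measurable_funM.
by move=> t _; rewrite /= lee_fin normrM ler_piMr.
Qed.

Lemma integrable_mul_cos h w c : mu.-integrable setT (EFin \o h) ->
  mu.-integrable setT (EFin \o (fun t => h t * cos (w * t + c))).
Proof.
move=> hi; apply: integrable_mul_bounded => //; last by move=> t; exact: cos_max.
by apply: continuous_measurable_fun; exact: continuous_cos_affine.
Qed.

Lemma trig_orthogonal_lin h h' (a b : R) : trig_orthogonal h -> trig_orthogonal h' ->
  trig_orthogonal (fun t => a * h t + b * h' t).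
Proof.
move=> [hi ho] [hi' ho']; split => [|w c].
  by have := integrableD measurableT (integrableZl measurableT a hi)
    (integrableZl measurableT b hi').
have Z k (u : R -> R) : mu.-integrable setT (EFin \o u) ->
    mu.-integrable setT (EFin \o (fun t => k * u t)).
  by move=> ui; have := integrableZl measurableT k ui.
have i1 := integrable_mul_cos w c hi; have i2 := integrable_mul_cos w c hi'.
under eq_Rintegral do rewrite mulrDl -!mulrA.
rewrite RintegralD//; [|exact: Z..].
by rewrite !RintegralZl// ho ho' !mulr0 addr0.
Qed.

(** The product of a cosine and a sine is a difference of two sines, that is of two cosines with
    phase shifted by [pi / 2]. *)
Lemma trig_orthogonal_sin h (v d : R) : trig_orthogonal h ->
  trig_orthogonal (fun t => h t * sin (v * t + d)).
Proof.
move=> [hi ho]; split => [|w c].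
  under eq_fun do rewrite -cosBpihalf -addrA; exact: integrable_mul_cos.
rewrite (_ : (fun t => _) = fun t =>
    2^-1 * (h t * cos ((w + v) * t + (c + d - pi / 2))) -
    2^-1 * (h t * cos ((w - v) * t + (c - d - pi / 2)))); last first.
  apply/funext => t.
  rewrite (_ : (w + v) * t + (c + d - pi / 2) = (w * t + c) + (v * t + d) - pi / 2);
    last by ring.
  rewrite (_ : (w - v) * t + (c - d - pi / 2) = (w * t + c) - (v * t + d) - pi / 2);
    last by ring.
  by move: (w * t + c) (v * t + d) => A B; rewrite !cosBpihalf sinD sinB; field.
have Z k (u : R -> R) : mu.-integrable setT (EFin \o u) ->
    mu.-integrable setT (EFin \o (fun t => k * u t)).
  by move=> ui; have := integrableZl measurableT k ui.
have i1 := integrable_mul_cos (w + v) (c + d - pi / 2) hi.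
have i2 := integrable_mul_cos (w - v) (c - d - pi / 2) hi.
rewrite RintegralB//; [|exact: Z..].
by rewrite !RintegralZl// !ho !mulr0 subr0.
Qed.

(** The values lie in [[0, 1]], and are below [1 / 2] exactly where the sine is positive. *)
Let X (v d t : R) := (1 - sin (v * t + d)) / 2.

Lemma trig_orthogonal_X h v d n : trig_orthogonal h ->
  trig_orthogonal (fun t => h t * X v d t ^+ n).
Proof.
move=> ho; elim: n => [|n IH]; first by under eq_fun do rewrite expr0 mulr1.
have := trig_orthogonal_lin 2^-1 (- 2^-1) IH (trig_orthogonal_sin v d IH).
by congr trig_orthogonal; apply/funext => t; rewrite exprSr /X; field.
Qed.

Lemma trig_orthogonal_1X h v d n m : trig_orthogonal h ->
  trig_orthogonal (fun t => h t * (1 - X v d t ^+ n) ^+ m).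
Proof.
move=> ho; elim: m => [|m IH]; first by under eq_fun do rewrite expr0 mulr1.
have := trig_orthogonal_lin 1 (- 1) IH (trig_orthogonal_X v d n IH).
by congr trig_orthogonal; apply/funext => t; rewrite exprSr; ring.
Qed.

Lemma bernoulli_ge (x : R) n : -1 <= x -> 1 + n%:R * x <= (1 + x) ^+ n.
Proof.
move=> x1; elim: n => [|n IH]; first by rewrite mul0r addr0 expr0.
rewrite exprS; apply: (@le_trans _ _ ((1 + x) * (1 + n%:R * x))).
  have : 0 <= n%:R * x ^+ 2 by rewrite mulr_ge0// sqr_ge0.
  rewrite -natr1; lra.
by apply: ler_wpM2l => //; lra.
Qed.

Lemma sin_ge_half (y : R) : 0 <= y <= 2^-1 -> y / 2 <= sin y.
Proof.
move=> /andP[y0 y1]; have [c /andP[c0 cy]] := MVT_global y0 (@is_derive_sin R).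
rewrite sin0 !subr0 => ->; rewrite mulrC; apply: ler_wpM2r => //.
have := cos_lipschitz c 0; rewrite cos0 subr0 (ger0_norm c0) ler_norml => /andP[]; lra.
Qed.

(* The Brosowski-Deutsch polynomials [(1 - X^n)^(2^n)] separate [X < 1/2] from
   [X > 1/2]. *)
Lemma brosowski_deutsch (s : R) n : `|s| <= 1 ->
  let Q := (1 - ((1 - s) / 2) ^+ n) ^+ (2 ^ n) in
  [/\ 0 <= Q <= 1, 0 <= s -> 1 - (1 + n%:R * s)^-1 <= Q &
   s <= 0 -> Q <= (1 + n%:R * - s)^-1].
Proof.
rewrite ler_norml => /andP[s1 s2] Q; set x := (1 - s) / 2 in Q *.
have x0 : 0 <= x by rewrite /x; lra.
have x1 : x <= 1 by rewrite /x; lra.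
have xn0 : 0 <= x ^+ n by exact: exprn_ge0.
have xn1 : x ^+ n <= 1 by exact: exprn_ile1.
have z2 : (2 ^ n)%:R * x ^+ n = (1 - s) ^+ n.
  by rewrite natrX -exprMn /x; congr (_ ^+ _); field.
have Q0 : 0 <= Q by apply: exprn_ge0; lra.
split.
- by rewrite Q0/= /Q exprn_ile1//; lra.
(* Bernoulli's inequality gives [Q >= 1 - (1 - s)^n]. Then [(1 - s)^n (1 + s)^n <= 1] and Bernoulli
   again bound [(1 - s)^n] by [1 / (1 + n s)]. *)
- move=> s0; have := @bernoulli_ge (- x ^+ n) (2 ^ n).
  rewrite mulrN z2 => /(_ _)/wrap[|]; first by lra.
  apply: le_trans; rewrite lerD2l lerN2.
  have ns : 0 <= n%:R * s by rewrite mulr_ge0.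
  rewrite -[leRHS]mul1r ler_pdivlMr; last by lra.
  apply: (@le_trans _ _ ((1 - s) ^+ n * (1 + s) ^+ n)).
    by apply: ler_wpM2l; [apply: exprn_ge0; lra|apply: bernoulli_ge; lra].
  by rewrite -exprMn exprn_ile1//; nra.
(* Here [Q (1 + x^n)^(2^n) = (1 - x^(2 n))^(2^n) <= 1], and two uses of Bernoulli's inequality bound
   the second factor below. *)
- move=> s0; have ns : 0 <= n%:R * - s by rewrite mulr_ge0// oppr_ge0.
  rewrite -[leRHS]mul1r ler_pdivlMr; last by lra.
  apply: (@le_trans _ _ (Q * (1 + x ^+ n) ^+ (2 ^ n))).
    apply: ler_wpM2l => //; apply: (@le_trans _ _ (1 + (2 ^ n)%:R * x ^+ n)).
      by rewrite z2; have := @bernoulli_ge (- s) n; lra.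
    by apply: bernoulli_ge; lra.
  by rewrite /Q -exprMn exprn_ile1//; nra.
Qed.

End trigonometric_uniqueness.

Section fourier_uniqueness.
Variable R : realType.

(* With a period growing like [k] and the exponent [k ^ 2], these trigonometric
   polynomials tend to the indicator of the positive half-line. *)
Let Q (k : nat) (u : R) : R :=
  (1 - ((1 - sin (k.+1%:R^-1 * u)) / 2) ^+ (k.+1 * k.+1)) ^+ (2 ^ (k.+1 * k.+1)).

(** Once [2 u <= k + 1], the sine is at least [u / (2 (k + 1))], so its product with [(k + 1)^2] is
    at least [(k + 1) u / 2]. *)
Let tail_le (u : R) : 0 < u -> \forall k \near \oo,
  (1 + (k.+1 * k.+1)%:R * sin (k.+1%:R^-1 * u))^-1 <= 2 / u * k.+1%:R^-1 :> R /\
  0 <= sin (k.+1%:R^-1 * u).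
Proof.
move=> u0; exists (Num.truncn (2 * u)).+1 => // k /= uk.
have ku : 2 * u <= k.+1%:R.
  apply: ltW; apply: lt_le_trans (truncnS_gt _) _; rewrite ler_nat.
  exact: leq_trans uk (leqnSn _).
set K : R := k.+1%:R in ku *; have K0 : 0 < K by rewrite /K.
have s2 : K^-1 * u / 2 <= sin (K^-1 * u).
  apply: sin_ge_half; apply/andP; split.
    by rewrite mulr_ge0// ?invr_ge0 ltW.
  by rewrite ler_pdivrMl//; lra.
have s0 : 0 <= sin (K^-1 * u).
  by apply: le_trans s2; rewrite mulr_ge0// mulr_ge0 ?invr_ge0 ?ltW.
split => //.
have Ku : 0 < K * u / 2 by rewrite mulr_gt0// mulr_gt0.
have -> : 2 / u * K^-1 = (K * u / 2)^-1 by field; rewrite !gt_eqF.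
rewrite lef_pV2 ?posrE//; last by rewrite ltr_pwDl// mulr_ge0.
apply: (@le_trans _ _ ((k.+1 * k.+1)%:R * (K^-1 * u / 2))).
  by rewrite natrM -/K le_eqVlt; apply/orP; left; apply/eqP; field; rewrite gt_eqF.
by rewrite -[leLHS]add0r; apply: lerD => //; apply: ler_wpM2l.
Qed.

Let tail_cvg (u : R) : (2 / u * k.+1%:R^-1) @[k --> \oo] --> (0 : R).
Proof. by rewrite -(mulr0 (2 / u)); apply: cvgMr; exact: cvg_harmonic. Qed.

Let Q01 k u : 0 <= Q k u <= 1.
Proof. by have [] := @brosowski_deutsch R (sin (k.+1%:R^-1 * u)) (k.+1 * k.+1) (sin_max _). Qed.

Let Q_cvg_pos (u : R) : 0 < u -> Q k u @[k --> \oo] --> (1 : R).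
Proof.
move=> u0; apply: (@squeeze_cvgr _ _ _ _ (fun k => 1 - 2 / u * k.+1%:R^-1) (cst 1)).
- near=> k; have /andP[_ ->] := Q01 k u; rewrite andbT.
  have [tle s0] : (1 + (k.+1 * k.+1)%:R * sin (k.+1%:R^-1 * u))^-1 <= 2 / u * k.+1%:R^-1
      /\ 0 <= sin (k.+1%:R^-1 * u) by near: k; exact: tail_le.
  have [_ /(_ s0) + _] := @brosowski_deutsch R _ (k.+1 * k.+1) (sin_max (k.+1%:R^-1 * u)).
  by apply: le_trans; rewrite lerD2l lerN2.
- rewrite -[X in _ --> X]subr0; apply: cvgB; [exact: cvg_cst|exact: tail_cvg].
- exact: cvg_cst.
Unshelve. all: by end_near. Qed.

Let Q_cvg_neg (u : R) : u < 0 -> Q k u @[k --> \oo] --> (0 : R).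
Proof.
move=> u0; have Nu0 : 0 < - u by rewrite oppr_gt0.
apply: (@squeeze_cvgr _ _ _ _ (cst 0) (fun k => 2 / - u * k.+1%:R^-1)).
- near=> k; have /andP[-> _] := Q01 k u; rewrite andTb.
  have [tle] : (1 + (k.+1 * k.+1)%:R * sin (k.+1%:R^-1 * - u))^-1 <= 2 / - u * k.+1%:R^-1
      /\ 0 <= sin (k.+1%:R^-1 * - u) by near: k; exact: tail_le.
  rewrite mulrN sinN oppr_ge0 => s0.
  have [_ _ /(_ s0)] := @brosowski_deutsch R _ (k.+1 * k.+1) (sin_max (k.+1%:R^-1 * u)).
  by move=> /le_trans; apply; move: tle; rewrite mulrN sinN.
- exact: cvg_cst.
- exact: tail_cvg.
Unshelve. all: by end_near. Qed.

Lemma trig_orthogonal_integral_itv (h : R -> R) a : trig_orthogonal h ->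
  \int[mu]_(t in `]a, +oo[) h t = 0.
Proof.
move=> ho; have [hi _] := ho.
have /measurable_EFinP mh := measurable_int mu hi.
pose f_ k : R -> \bar R := EFin \o (fun t => h t * Q k (t - a)).
have fo k : trig_orthogonal (fun t => h t * Q k (t - a)).
  have := trig_orthogonal_1X k.+1%:R^-1 (- (k.+1%:R^-1 * a)) (k.+1 * k.+1)
    (2 ^ (k.+1 * k.+1)) ho.
  by congr trig_orthogonal; apply/funext => t; rewrite /Q mulrBr.
have int0 (u : R -> R) : trig_orthogonal u -> \int[mu]_t u t = 0.
  move=> [_ /(_ 0 0) <-]; apply: eq_Rintegral => t _.
  by rewrite mul0r addr0 cos0 mulr1.
have mf_ k : measurable_fun setT (f_ k) by exact: (measurable_int mu (fo k).1).
have mf : measurable_fun setT (EFin \o (h \_ `]a, +oo[)).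
  apply/measurable_EFinP; apply/(measurable_restrictT _ _).1 => //.
  exact: measurable_funTS.
have f_f : {ae mu, forall t : R, [set: R] t ->
    f_ ^~ t @ \oo --> (EFin \o (h \_ `]a, +oo[)) t}.
  (* At [t = a] the sine is [0] for every [k] and [Q k 0] tends to [1 / e], so this null set has to
     be removed. *)
  exists [set a]; split => //; first exact: lebesgue_measure_set1.
  move=> t /= /not_implyP[_ nt]; apply: contrapT => ta; apply: nt.
  apply: cvg_EFin; first exact: nearW.
  rewrite (_ : fine \o _ = fun k => h t * Q k (t - a))//.
  rewrite patchE; case: ifPn => [|]; rewrite ?inE/= ?notin_setE/= in_itv/= andbT.
    move=> ta'; rewrite -[X in _ --> X]mulr1; apply: cvgMr; apply: Q_cvg_pos.
    by rewrite subr_gt0.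
  move=> /negP; rewrite -leNgt le_eqVlt => /predU1P[//|ta'].
  have : (fun k => h t * Q k (t - a)) @ \oo --> h t * 0.
    by apply: cvgMr; apply: Q_cvg_neg; rewrite subr_lt0.
  by rewrite mulr0.
have f_le : {ae mu, forall (t : R) n, [set: R] t -> (`|f_ n t| <= `|h t|%:E)%E}.
  apply: aeW => t n _; rewrite /f_/= lee_fin normrM ler_piMr//.
  by have /andP[q0 q1] := Q01 n (t - a); rewrite ger0_norm.
have [fi _ H] := @dominated_convergence _ (measurableTypeR R) R mu setT measurableT
  f_ _ _ mf_ mf f_f (integrable_norm hi) f_le.
have int_f_ k : (\int[mu]_t f_ k t = 0)%E.
  rewrite -(fineK (integrable_fin_num _ (fo k).1))//.
  by have := int0 _ (fo k); rewrite /Rintegral => ->.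
rewrite Rintegral_mkcond /Rintegral.
suff -> : (\int[mu]_t (h \_ `]a, +oo[ t)%:E = 0)%E by [].
rewrite (_ : [sequence _]_n = cst 0%E) in H; last exact/funext.
by rewrite -(cvg_lim (@ereal_hausdorff R) H) lim_cst//; exact: ereal_hausdorff.
Qed.

(** The integral of [h] vanishes on the line and on every right half-line, hence on every left
    half-line. By Lebesgue differentiation [h] is almost everywhere the derivative of the zero
    function. *)
Lemma trig_orthogonal_ae0 (h : R -> R) : trig_orthogonal h ->
  {ae mu, forall t : R, h t = 0}.
Proof.
move=> ho; have [hi h0] := ho.
have iN y : mu.-integrable `]-oo, y] (EFin \o h) by exact: integrableS hi.
have lh : locally_integrable [set: R] h.
  by apply: open_integrable_locally => //; exact: openT.
have := FTC1Ny iN lh.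
have -> : (fun x => \int[mu]_(t in `]-oo, x]) h t) = cst 0.
  apply/funext => x; have : \int[mu]_t h t = 0.
    rewrite -(h0 0 0); apply: eq_Rintegral => t _.
    by rewrite mul0r addr0 cos0 mulr1.
  rewrite -(setUv `]-oo, x]%classic) Rintegral_setU//.
  - by rewrite setCitvl trig_orthogonal_integral_itv// addr0.
  - exact: measurableC.
  - by rewrite setUv.
  - exact/disj_setPCl.
by apply: ae_imply => t [_ <-]; rewrite derive1_cst.
Qed.

(** Each equation mixes the real and imaginary parts of [f]. Comparing the frequencies [W] and [- W]
    separates them by the parity of the cosine and the sine, and each part is then orthogonal to all
    sinusoids. *)
Lemma fourierL1_eq0_ae (f : R -> R[i]) : cintegrable f ->
  (forall w, fourierL1 f w = 0) -> {ae mu, forall t : R, f t = 0}.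
Proof.
move=> fi fw; have [f1 f2] := fi.
have C (u : R -> R) (W : R) : mu.-integrable setT (EFin \o u) ->
    mu.-integrable setT (EFin \o (fun t => u t * cos (W * t))).
  move=> ui; have := integrable_mul_cos W 0 ui.
  by under eq_fun do rewrite addr0.
have S (u : R -> R) (W : R) : mu.-integrable setT (EFin \o u) ->
    mu.-integrable setT (EFin \o (fun t => u t * sin (W * t))).
  move=> ui; have := integrable_mul_cos W (- (pi / 2)) ui.
  by under eq_fun do rewrite cosBpihalf.
have split (W : R) :
    \int[mu]_t (complex.Re (f t) * cos (W * t)) +
    \int[mu]_t (complex.Im (f t) * sin (W * t)) = 0 /\
    \int[mu]_t (complex.Im (f t) * cos (W * t)) -
    \int[mu]_t (complex.Re (f t) * sin (W * t)) = 0.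
  have := fw (W / (2 * pi)); rewrite /fourierL1 /cintegral => -[e1 e2].
  have ph t : - (2 * pi * t * (W / (2 * pi))) = - (W * t).
    have : pi != 0 :> R by rewrite gt_eqF ?pi_gt0.
    by move: pi => q q0; field.
  split.
    rewrite -RintegralD//; [|exact: C|exact: S].
    rewrite -e1; apply: eq_Rintegral => t _.
    by rewrite ReM/= ph cosN sinN; ring.
  rewrite -RintegralB//; [|exact: C|exact: S].
  rewrite -e2; apply: eq_Rintegral => t _.
  by rewrite ImM/= ph cosN sinN; ring.
have RN (u : R -> R) : mu.-integrable setT (EFin \o u) ->
    \int[mu]_t (- u t) = - \int[mu]_t u t.
  move=> ui; under eq_Rintegral do rewrite -mulN1r.
  by rewrite RintegralZl// mulN1r.
have NW (u : R -> R) (W : R) : mu.-integrable setT (EFin \o u) ->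
    \int[mu]_t (u t * cos (- W * t)) = \int[mu]_t (u t * cos (W * t)) /\
    \int[mu]_t (u t * sin (- W * t)) = - \int[mu]_t (u t * sin (W * t)).
  move=> ui; split.
    by apply: eq_Rintegral => t _; rewrite mulNr cosN.
  rewrite -RN; last exact: S.
  by apply: eq_Rintegral => t _; rewrite mulNr sinN mulrN.
have ortho (u : R -> R) : mu.-integrable setT (EFin \o u) ->
    (forall W : R, \int[mu]_t (u t * cos (W * t)) = 0 /\
      \int[mu]_t (u t * sin (W * t)) = 0) -> trig_orthogonal u.
  move=> ui u0; split => // W c.
  have Z k (v : R -> R) : mu.-integrable setT (EFin \o v) ->
      mu.-integrable setT (EFin \o (fun t => k * v t)).
    by move=> vi; have := integrableZl measurableT k vi.
  rewrite (_ : (fun t => _) = fun t => cos c * (u t * cos (W * t)) -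
      sin c * (u t * sin (W * t))); last first.
    by apply/funext => t; rewrite cosD; ring.
  rewrite RintegralB//; [|exact/Z/C|exact/Z/S].
  rewrite !RintegralZl//; [|exact: S|exact: C].
  by have [-> ->] := u0 W; rewrite !mulr0 subr0.
have all0 (W : R) : (\int[mu]_t (complex.Re (f t) * cos (W * t)) = 0 /\
    \int[mu]_t (complex.Re (f t) * sin (W * t)) = 0) /\
    (\int[mu]_t (complex.Im (f t) * cos (W * t)) = 0 /\
    \int[mu]_t (complex.Im (f t) * sin (W * t)) = 0).
  have solve (p q u v : R) : p + q = 0 -> u - v = 0 -> p + - q = 0 -> u - - v = 0 ->
      (p = 0 /\ v = 0) /\ (u = 0 /\ q = 0).
    by clear => *; do !split; lra.
  have [a1 a2] := split W; have := split (- W).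
  have [-> ->] := NW _ W f1; have [-> ->] := NW _ W f2 => -[b1 b2].
  exact: solve.
have o1 := ortho _ f1 (fun W => (all0 W).1).
have o2 := ortho _ f2 (fun W => (all0 W).2).
apply: ae_imply2 (trig_orthogonal_ae0 o1) (trig_orthogonal_ae0 o2) => t.
by case: (f t) => x y /= -> ->.
Qed.

End fourier_uniqueness.

(** * From the support of the short-time Fourier transform to that of the window *)

Section essential_support.
Variable R : realType.

(** By Tonelli's theorem the indicator of [B] has integral [0] in either order, so almost every
    slice in the other direction is null. *)
Lemma ae_swap (B : R * R -> bool) : measurable_fun setT B ->
  (forall x, {ae mu, forall t : R, ~~ B (x, t)}) ->
  {ae mu, forall t : R, {ae mu, forall x : R, ~~ B (x, t)}}.
Proof.
move=> mB Bx.
pose f (z : R * R) : \bar R := ((B z)%:R)%:E.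
have mf : measurable_fun setT f.
  apply/measurable_EFinP.
  rewrite (_ : (fun z => _) = fun z => if B z then 1 else 0); last first.
    by apply/funext => z; case: (B z).
  exact: measurable_fun_ifT.
have f0 z : (0 <= f z)%E by rewrite lee_fin.
have E := fubini_tonelli (m1 := mu) (m2 := mu) f mf f0.
have I0 : (\int[mu]_y \int[mu]_x f (x, y) = 0)%E.
  rewrite -E (_ : (fun x => _) = cst 0%E) ?integral0//.
  apply/funext => x.
  transitivity (\int[mu]_y (cst 0%E : R -> \bar R) y)%E; last by rewrite integral0.
  apply: ae_eq_integral => //.
    exact: (measurable_fun_pair2 (f := f)).
  by apply: ae_imply (Bx x) => t nB _; rewrite /f (negbTE nB).
have mG : measurable_fun setT (fun y => \int[mu]_x f (x, y))%E.
  exact: (measurable_fun_fubini_tonelli_G (m1 := mu) f mf f0).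
have G0 : {ae mu, forall t : R, [set: R] t -> (\int[mu]_x f (x, t) = 0)%E}.
  apply/(ae_eq_integral_abs mu measurableT mG).
  by under eq_integral do rewrite gee0_abs ?integral_ge0//.
apply: ae_imply G0 => t /(_ I) It0.
have mft : measurable_fun setT (fun x => f (x, t)).
  exact: (measurable_fun_pair1 (f := f)).
have : {ae mu, forall x : R, [set: R] x -> (f (x, t) = 0)%E}.
  apply/(ae_eq_integral_abs mu measurableT mft).
  by under eq_integral do rewrite gee0_abs//.
apply: ae_imply => x /(_ I); rewrite /f; case: (B (x, t)) => //= -[] /eqP.
by rewrite oner_eq0.
Qed.

(* The interval starts at the essential infimum of [A]. *)
Lemma ess_diameter_interval (A : R -> bool) (r : R) :
  {ae mu, forall t : R, A t -> {ae mu, forall s : R, A s -> `|s - t| <= r}} ->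
  exists a, {ae mu, forall t : R, A t -> a <= t <= a + r}.
Proof.
move=> AA.
have [A0|nA0] := pselect {ae mu, forall t : R, ~~ A t}.
  by exists 0; apply: ae_imply A0 => t /negP.
(* A property failing on a non-null part of [A] fails at some point of [A] that is also within [r]
   of almost all of [A]. *)
have good (P : R -> Prop) : ~ {ae mu, forall t : R, A t -> P t} ->
    exists t, [/\ A t, ~ P t & {ae mu, forall s : R, A s -> `|s - t| <= r}].
  move=> nP; apply: contrapT => /forallNP nt; apply: nP.
  apply: ae_imply AA => t + At => /(_ At) tA; apply: contrapT => nPt.
  by apply: (nt t); split.
have [t0 [At0 _ tA0]] : exists t, [/\ A t, ~ False &
    {ae mu, forall s : R, A s -> `|s - t| <= r}].
  by apply: good => H; apply: nA0; apply: ae_imply H => t nA; apply/negP.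
pose S := [set c : R | {ae mu, forall s : R, A s -> c <= s}].
have S0 : S (t0 - r).
  by apply: ae_imply tA0 => s /[apply]; rewrite ler_norml => /andP[]; lra.
have Sub : ubound S (t0 + r).
  move=> c Sc; rewrite leNgt; apply/negP => tc; apply: nA0.
  apply: ae_imply2 Sc tA0 => s Sc tA0; apply/negP => As.
  by move: (Sc As) (tA0 As); rewrite ler_norml => ? /andP[]; lra.
have hS : has_sup S by split; [exists (t0 - r)|exists (t0 + r)].
have eps n : 0 < n.+1%:R^-1 :> R by rewrite invr_gt0.
have lim_le (x y : R) : (forall n : nat, x <= y + n.+1%:R^-1) -> x <= y.
  move=> xy; apply/ler_addgt0Pr => e e0.
  apply: le_trans (xy (Num.truncn e^-1)) _; rewrite lerD2l.
  by rewrite invf_ple ?posrE// ltW// truncnS_gt.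
have lower : {ae mu, forall s : R, A s -> sup S <= s}.
  have : {ae mu, forall s : R, forall n : nat, A s -> sup S <= s + n.+1%:R^-1}.
    apply: ae_foralln => n; have [c Sc cS] := sup_adherent (eps n) hS.
    apply: ae_imply Sc => s /[apply] cs; rewrite -lerBlDr.
    exact: le_trans (ltW cS) cs.
  by apply: ae_imply => s sn As; apply: lim_le => n; exact: sn.
have upper : {ae mu, forall s : R, A s -> s <= sup S + r}.
  have : {ae mu, forall s : R, forall n : nat, A s -> s <= sup S + r + n.+1%:R^-1}.
    apply: ae_foralln => n.
    (* A number above [sup S] is not an essential lower bound, so some good [t] lies below it, and
       almost all of [A] is at most [t + r]. *)
    have [|t [At /negP + tA]] := good (fun s => sup S + n.+1%:R^-1 <= s).
      by move=> /(ub_le_sup hS.2); rewrite gerDl leNgt eps.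
    rewrite -ltNge => tS; apply: ae_imply tA => s /[apply].
    rewrite ler_norml => /andP[_]; rewrite lerBlDl => /le_trans; apply.
    by rewrite addrAC lerD2r ltW.
  by apply: ae_imply => s sn As; apply: lim_le => n; exact: sn.
by exists (sup S); apply: ae_imply2 lower upper => s l u As; rewrite l ?u.
Qed.

(** For fixed [x], the short-time Fourier transform of [g] is the Fourier transform of the
    integrable product [g t * (g (t - x))^*]. Injectivity makes this product null for [|x| > r], and
    exchanging the quantifiers shows that almost all points of the support lie within [r] of one
    another. *)
Lemma stft_support (r : R) (g : R -> R[i]) : 0 < r -> inL 2%:E g ->
  (forall x w : R, x \notin `[- r, r] -> stft g g x w = 0) ->
  exists a, {ae mu, forall t : R, t \notin `[a, a + r] -> g t = 0}.
Proof.
move=> r0 gi g0; have /inL2P[mg _] := gi.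
have prod0 (x : R) : r < `|x| -> {ae mu, forall t : R, g t * (g (t - x))^* = 0}.
  move=> xr; apply: fourierL1_eq0_ae.
    by apply: cintegrableM => //; apply: inL2J; exact: inL2_shift.
  move=> w; apply: (g0 x w); rewrite in_itv/= -ler_norml -ltNge//.
pose A t := g t != 0.
have mA : measurable_fun setT A.
  have -> : A = (fun t => 0 < normc (g t)).
    apply/funext => t; rewrite /A lt0r normc_ge0 andbT; congr (~~ _).
    by apply/eqP/eqP => [->|/eq0_normc//]; rewrite normc0.
  by apply: measurable_fun_ltr => //; exact: measurable_normc.
have mA1 : measurable_fun setT (fun z : R * R => A z.2).
  exact: (measurableT_comp mA measurable_snd).
have m21 : measurable_fun setT (fun z : R * R => z.2 - z.1).
  by apply: measurable_funB.
pose B (z : R * R) := [&& r < `|z.1|, A z.2 & A (z.2 - z.1)].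
have mB : measurable_fun setT B.
  apply: measurable_and.
    apply: measurable_fun_ltr => //.
    by apply: measurableT_comp => //.
  apply: measurable_and => //.
  exact: (measurableT_comp mA m21).
have Bx (x : R) : {ae mu, forall t : R, ~~ B (x, t)}.
  have [xr|xr] := ltP r `|x|; last first.
    by apply: aeW => t; rewrite /B/= ltNge xr.
  apply: ae_imply (prod0 x xr) => t gt; rewrite /B/= xr/= /A -negb_or negbK.
  move/eqP: gt; rewrite mulf_eq0 => /orP[->//|/eqP gtx].
  by rewrite orbC; have := congr1 Num.conj gtx; rewrite conjCK rmorph0 => ->; rewrite eqxx.
have BB := ae_swap mB Bx.
have AA : {ae mu, forall t : R, A t ->
    {ae mu, forall s : R, A s -> `|s - t| <= r}}.
  apply: ae_imply BB => t Bt At.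
  (* The reflection [x = t - s] turns a statement on shifts into one on points [s] of the
     support. *)
  have := ae_subl t Bt; apply: ae_imply => s; rewrite /B/= At (_ : t - (t - s) = s); last by ring.
  by move=> + As; rewrite As /= andbT -leNgt distrC.
have [a Ha] := ess_diameter_interval AA.
by exists a; apply: ae_imply Ha => t At; rewrite in_itv/=; apply: contraNeq => /At.
Qed.

End essential_support.

(** * The counterexample *)

Section counterexample.
Variable R : realType.

Lemma ae_exists_itv (P : R -> Prop) (a b : R) : a < b ->
  {ae mu, forall t : R, P t} -> exists2 t, a < t < b & P t.
Proof.
move=> ab [N [mN N0 PN]]; apply: contrapT => /forall2NP nP.
have : (mu `]a, b[%classic <= mu N)%E.
  apply: le_measure; rewrite ?inE//.
  by move=> t /=; rewrite in_itv/= => tab; apply: PN => /= Pt; have [] := nP t.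
rewrite [X in (_ <= X)%E -> _]N0 lebesgue_measure_itv/= lte_fin ab -EFinD lee_fin.
by rewrite subr_le0 leNgt ab.
Qed.

Lemma stft_eq0_support (r a x w : R) (g : R -> R[i]) : cmeasurable g ->
  {ae mu, forall t : R, t \notin `[a, a + r] -> g t = 0} ->
  x \notin `[- r, r] -> stft g g x w = 0.
Proof.
move=> mg g0; rewrite in_itv/= -ler_norml -ltNge => rx.
have m0 : cmeasurable (cst 0 : R -> R[i]) by exact: cmeasurable_cst.
have -> : 0 = stft g (cst 0) x w :> R[i].
  rewrite /stft /cintegral.
  under eq_Rintegral do rewrite !mul0r/=.
  under [X in _ +i* X]eq_Rintegral do rewrite !mul0r/=.
  by rewrite /Rintegral !integral0.
apply: ae_eq_stft => //; apply: ae_imply2 g0 (ae_shift x g0) => t gt gtx.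
rewrite mul0r; have [ta|/gt ->] := boolP (t \in `[a, a + r]); last by rewrite mul0r.
rewrite gtx ?rmorph0 ?mulr0//; apply/negP => tx.
move: ta tx rx; rewrite !in_itv/= => /andP[t1 t2] /andP[t3 t4].
by rewrite ltNge ler_norml => /negP; apply; apply/andP; split; lra.
Qed.

Lemma fourierL1_step_eq0 (L w : R) (s : nat -> R) : 0 < L -> quadratic_decay s ->
  w != 0 -> series (cosine_term s (2 * pi * w * L)) @ \oo --> 0 ->
  fourierL1 (fun t => (step L s t)%:C) w = 0.
Proof.
move=> L0 sd w0 s0; have [D sD ->] := fourierL1_stepE L0 sd w0.
by rewrite (_ : D = 0) ?mulr0//; rewrite -(cvg_lim (@Rhausdorff R) sD); exact: cvg_lim.
Qed.

(* The step functions of [s] and of [(-1) ^ k * s k] are the sum and the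
   difference of the two functions compared, and for each [w] one of them has no
   spectrum in [w - [a, a + r]]. *)
Lemma same_spectrogram_fourierL2 (L r a : R) (s fe fo : nat -> R) (g : R -> R[i]) :
  0 < L -> 2 * pi * L * r <= 1 -> inL 2%:E g ->
  {ae mu, forall t : R, t \notin `[a, a + r] -> g t = 0} ->
  quadratic_decay s -> quadratic_decay fe -> quadratic_decay fo ->
  (forall k, s k = fe k + fo k) -> (forall k, (-1) ^+ k * s k = fe k - fo k) ->
  lowpass (1 / 2) s ->
  same_spectrogram (fourierL2 g) (fun t => (step L fe t)%:C) (fun t => (step L fo t)%:C).
Proof.
move=> L0 Lr gi g0 sd fed fod sE sN slow x w.
(* If no function qualified as transform of [g], the default value of [fourierL2 g] would be the
   zero window and both sides would be [0]. Otherwise [xget] returns an actual transform. *)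
have [[h Sh]|nS] := pselect ([set h | inL 2%:E h /\ is_fourierL2 g h] !=set0); last first.
  rewrite /fourierL2 xgetPN; last by move=> h Sh; apply: nS; exists h.
  by congr normc; apply: eq_cintegral => t; rewrite conjC0 !mulr0.
have [hi hg] : inL 2%:E (fourierL2 g) /\ is_fourierL2 g (fourierL2 g).
  by have := xgetPex (cst 0) (ex_intro _ h Sh).
have sd' : quadratic_decay (fun k => (-1) ^+ k * s k).
  apply: quadratic_decay_le sd _ => k.
  by rewrite normrM normrX normrN1 expr1n mul1r.
have vanish (u : nat -> R) : quadratic_decay u ->
    (forall t, t \in `[a, a + r] ->
      series (cosine_term u (2 * pi * (w - t) * L)) @ \oo --> 0) ->
    stft (fourierL2 g) (fun t => (step L u t)%:C) x w = 0.
  move=> ud u0; apply: (@stft_is_fourierL2_eq0 _ g (fourierL2 g)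
    (fun t => (step L u t)%:C) x w gi hi hg).
  - exact: inL1_step.
  - exact: inL2_step.
  - exact: inL2_fourierL1_step.
  (* The formula for the transform of a step function requires a nonzero frequency [w - t]; the
     single exceptional [t] is null. *)
  have tw : {ae mu, forall t : R, t != w}.
    exists [set w]; split => //; first exact: lebesgue_measure_set1.
    by move=> t /= /negP; rewrite negbK => /eqP.
  apply: ae_imply2 g0 tw => t gt tw.
  have [ta|/gt ->] := boolP (t \in `[a, a + r]); last by rewrite conjC0 mul0r.
  by rewrite fourierL1_step_eq0 ?mulr0// ?subr_eq0 1?eq_sym//; exact: u0.
have ei := inL2_step L0 fed; have oi := inL2_step L0 fod.
have pE : stft (fourierL2 g) (fun t => (step L s t)%:C) x w =
    stft (fourierL2 g) (fun t => (step L fe t)%:C) x w +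
    stft (fourierL2 g) (fun t => (step L fo t)%:C) x w.
  rewrite -stftD//; apply: eq_cintegral => t.
  by rewrite /step sE rmorphD.
have qE : stft (fourierL2 g) (fun t => (step L (fun k => (-1) ^+ k * s k) t)%:C) x w =
    stft (fourierL2 g) (fun t => (step L fe t)%:C) x w -
    stft (fourierL2 g) (fun t => (step L fo t)%:C) x w.
  rewrite -stftN// -stftD//; last exact: inL2N.
  by apply: eq_cintegral => t; rewrite /step sN rmorphB.
(* Either the series of [s] vanishes at all frequencies seen by the window, and the two transforms
   are opposite, or some frequency has cosine above [1 / 2]. As [2 * pi * L * r <= 1], the cosine
   then stays above [- 1 / 2] on the whole interval, where the alternating series vanishes, and the
   two transforms are equal. *)
have [H|/existsNP[t /not_implyP[ta /negP]]] := pselect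
    (forall t, t \in `[a, a + r] -> cos (2 * pi * (w - t) * L) <= 1 / 2).
  have := vanish s sd (fun t ta => slow _ (H t ta)); rewrite pE => /eqP.
  by rewrite addr_eq0 => /eqP ->; rewrite normcN.
rewrite -ltNge => ct.
have := vanish _ sd' _; rewrite qE => H.
suff /eqP : stft (fourierL2 g) (fun t => (step L fe t)%:C) x w -
    stft (fourierL2 g) (fun t => (step L fo t)%:C) x w = 0.
  by rewrite subr_eq0 => /eqP ->.
apply: H => t' ta'; apply: (lowpass_alternating slow).
have := cos_lipschitz (2 * pi * (w - t) * L) (2 * pi * (w - t') * L).
rewrite (_ : 2 * pi * (w - t) * L - 2 * pi * (w - t') * L =
  2 * pi * L * (t' - t)); last by ring.
have pL : 0 <= 2 * pi * L by rewrite !mulr_ge0 ?pi_ge0// ltW.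
have tt' : `|t' - t| <= r.
  by move: ta ta'; rewrite !in_itv/= ler_norml => /andP[? ?] /andP[? ?]; lra.
rewrite normrM (ger0_norm pL) => le.
have {}le := le_trans le (le_trans (ler_wpM2l pL tt') Lr).
by move: le; rewrite ler_norml => /andP[_]; lra.
Qed.

(** A cell of positive index has positive measure on each side of [0], so an almost everywhere
    property can be evaluated on it at a point of prescribed sign. *)
Lemma step_neq0 (L : R) (s : nat -> R) (k : nat) (sg : bool) (P : R -> Prop) :
  0 < L -> (0 < k)%N -> {ae mu, forall t : R, P t} ->
  exists t, [/\ P t, step L s t = s k & (t < 0) = sg].
Proof.
move=> L0 k0 aeP.
have kb : (k%:R - 2^-1) * L < (k.+1%:R - 2^-1) * L.
  by rewrite ltr_pM2r// ltrD2r ltr_nat.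
have k1 : 0 < (k%:R - 2^-1) * L.
  rewrite mulr_gt0// subr_gt0 (@lt_le_trans _ _ 1)//; first by lra.
  by rewrite ler1n.
have cell t : (k%:R - 2^-1) * L < `|t| < (k.+1%:R - 2^-1) * L -> step L s t = s k.
  move=> /andP[t1 t2]; rewrite /step; congr s; apply/eqP; rewrite eqn_leq.
  by rewrite -ltnS cell_index_lt// t2/= leqNgt cell_index_lt// -leNgt ltW.
case: sg.
  have [|t /andP[t1 t2] Pt] := @ae_exists_itv P (- ((k.+1%:R - 2^-1) * L))
    (- ((k%:R - 2^-1) * L)) _ aeP; first by rewrite ltrN2.
  have t0 : t < 0 by lra.
  by exists t; split => //; apply: cell; rewrite ltr0_norm//; apply/andP; split; lra.
have [t /andP[t1 t2] Pt] := ae_exists_itv kb aeP.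
have t0 : 0 < t by lra.
exists t; split => //; last by apply/negbTE; rewrite -leNgt ltW.
by apply: cell; rewrite gtr0_norm// t1.
Qed.

End counterexample.

Theorem theorem2p10 (R : realType) (r : R) (hr : 0 < r)
    (g : R -> R[i]) (hg : inL 2%:E g) :
  ((exists a : R, {ae lebesgue_measure, forall t : R,
      t \notin `[a, a + r] -> g t = 0})
   <-> (forall x w : R, x \notin `[- r, r] -> stft g g x w = 0))
  /\
  ((exists a : R, {ae lebesgue_measure, forall t : R,
      t \notin `[a, a + r] -> g t = 0}) ->
   exists f f1 f2 : R -> R[i],
     [/\ [/\ inL 2%:E f, inL 2%:E f1 & inL 2%:E f2],
         ~ in_phase_orbit f f1 /\ ~ in_phase_orbit f f2,
         same_spectrogram g f f1 /\ same_spectrogram (fourierL2 g) f f2 &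
         ~ phase_retrievable g f /\ ~ phase_retrievable (fourierL2 g) f]).
Proof.
have /inL2P[mg _] := hg.
split.
  split=> [[a ga] x w xr|]; last exact: stft_support.
  exact: stft_eq0_support mg ga xr.
move=> [a ga].
(* With this mesh, frequencies at distance at most [r] correspond to arguments of the cosine series
   at distance at most [1]. *)
pose L := (2 * pi * r)^-1; have L0 : 0 < L by rewrite invr_gt0 !mulr_gt0// pi_gt0.
have Lr : 2 * pi * L * r <= 1.
  by rewrite mulrAC /L divff// !mulf_neq0// gt_eqF// pi_gt0.
have [m mr] : exists m : nat, r < m%:R * L.
  by exists (Num.truncn (r / L)).+1; rewrite -ltr_pdivrMr// truncnS_gt.
have [s [sd s0 s1 s2 slow]] := @exists_gap_sequence R m.
pose fe k := if odd k then 0 else s k.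
pose fo k := if odd k then s k else 0.
have fed : quadratic_decay fe.
  by apply: quadratic_decay_le sd _ => k; rewrite /fe; case: ifP; rewrite ?normr0.
have fod : quadratic_decay fo.
  by apply: quadratic_decay_le sd _ => k; rewrite /fo; case: ifP; rewrite ?normr0.
(* One of [m.+1] and [m.+2] is even and the other is odd, and [s] is nonzero at both. *)
have [ke [ke0 keven ske]] : exists k, [/\ (0 < k)%N, ~~ odd k & s k != 0].
  have [mo|mo] := boolP (odd m).
    by exists m.+1; rewrite /= mo.
  by exists m.+2; rewrite /= negbK mo.
have [ko [ko0 kodd sko]] : exists k, [/\ (0 < k)%N, odd k & s k != 0].
  have [mo|mo] := boolP (odd m).
    by exists m.+2; rewrite /= negbK mo.
  by exists m.+1; rewrite /= mo.
pose f t := (step L fe t)%:C.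
pose f1 t := (if t < 0 then -1 else 1) * f t.
pose f2 t := (step L fo t)%:C.
have fi : inL 2%:E f by exact: inL2_step.
have f2i : inL 2%:E f2 by exact: inL2_step.
have f1i : inL 2%:E f1 by exact: inL2_sign.
have f1g : same_spectrogram g f f1.
  apply: (same_spectrogram_sign hr hg fi ga) => t tr.
  rewrite /f /step (_ : fe _ = 0)// /fe s0 ?if_same//.
  (* Index at most [m] means [|t| < (m + 1 / 2) L], which holds on [[- r, r]] because [r < m L]. *)
  rewrite -ltnS cell_index_lt//; apply: (le_lt_trans tr); apply: (lt_le_trans mr).
  by rewrite ler_pM2r// -natr1; lra.
have f2g : same_spectrogram (fourierL2 g) f f2.
  apply: (same_spectrogram_fourierL2 L0 Lr hg ga sd) => // k.
    by rewrite /fe /fo; case: ifP => _; rewrite ?add0r ?addr0.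
  rewrite /fe /fo -signr_odd; case: (odd k); first by rewrite expr1 mulN1r sub0r.
  by rewrite expr0 mul1r subr0.
(* On the cell [ke], where [f] is nonzero, the left half would force [c = -1] and the right half
   [c = 1]. *)
have f1f : ~ in_phase_orbit f f1.
  move=> [c _ cf].
  have [t [ft tE t0]] := step_neq0 fe true L0 ke0 cf.
  have [t' [ft' tE' t0']] := step_neq0 fe false L0 ke0 cf.
  have fk : (fe ke)%:C != 0 :> R[i].
    by rewrite /fe (negbTE keven) eq_complex/= negb_and ske.
  move: ft ft'; rewrite /f1 /f tE tE' t0 t0'.
  move=> /(mulIf fk) <- /(mulIf fk) /eqP.
  by rewrite -subr_eq0 opprK (_ : 1 + 1 = 2%:R)// pnatr_eq0.
(* On the odd cell [ko] the function [f] vanishes while [f2] does not. *)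
have f2f : ~ in_phase_orbit f f2.
  move=> [c _ cf].
  have [t [ft tE t0]] := step_neq0 fo true L0 ko0 cf.
  move: ft; rewrite /f2 tE /f /step.
  have -> : fe (cell_index L t) = 0.
    rewrite /fe; case: ifPn => // te; move: tE; rewrite /step /fo (negbTE te) kodd.
    by move=> sk; move: sko; rewrite -sk eqxx.
  rewrite mulr0 /fo kodd => /eqP; rewrite eq_complex/= => /andP[].
  by rewrite (negbTE sko).
exists f, f1, f2; split => //; split => H.
  by apply: f1f; exact: H.
by apply: f2f; exact: H.
Qed.
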